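(* For every $a\in[0,2/e]$ and every $b\in[a,\beta(a)]$, there is a nondecreasing function $\tau:\mathbb R\to\mathbb R$ with $\tau(t)\le t$ and $\tau(t)\to\infty$ as $t\to\infty$ for which the equation $$x''(t)=x(\tau(t))$$ admits a strictly positive decreasing solution, with $$\liminf_{t\to\infty}(t-\tau(t))=a,\qquad \limsup_{t\to\infty}(t-\tau(t))=b.$$
   Context: Differential equations are understood in the Carathéodory sense: a solution on a half-line $[t_0,\infty)$ is a function that is continuous on an interval containing $[t_0,\infty)$ and $\tau([t_0,\infty))$, is $C^1$ with locally absolutely continuous derivative on $[t_0,\infty)$, and satisfies the equation for almost every $t\ge t_0$. Definition of $\beta:[0,2/e]\to[2/e,\sqrt2]$. Put $\beta(0)=\sqrt2$ and $\beta(2/e)=2/e$. For $0<a<2/e$, $\beta(a)$ is the unique $b\in(a,\sqrt2)$ with $\mathcal E(a,b)=1$, where $\mathcal E(a,b)$ is defined as follows. Let $X_{2/a}$ be the Banach space of $f\in C(\mathbb R)$ with $\|f\|=\sup_{t\in\mathbb R}e^{2t/a}|f(t)|<\infty$. Let $(S_af)(t)=f(t-a)$ and $(Tg)(t)=\int_t^\infty(u-t)g(u)\,du$. For $b\ge a$ let $\mathbf 1_{[a,b]}$ and $\mathbf 1_{[a,b]^c}$ denote the indicator functions of $[a,b]$ and of its complement in $\mathbb R$ (also the corresponding multiplication operators). Then $$\Phi_{a,b}=\sum_{j=0}^\infty\bigl(T\,\mathbf 1_{[a,b]^c}S_a\bigr)^j\,T\mathbf 1_{[a,b]}$$ (convergent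 in $X_{2/a}$), and $\mathcal E(a,b)=\Phi_{a,b}(0)$. *)

(* Defs.v *)
From HB Require Import structures.
From mathcomp Require Import all_boot all_order all_algebra.
From mathcomp Require Import all_classical all_reals all_analysis.
Set Implicit Arguments.
Unset Strict Implicit.
Unset Printing Implicit Defensive.
Import Order.TTheory GRing.Theory Num.Theory.
Import numFieldNormedType.Exports.

Local Open Scope classical_set_scope.
Local Open Scope ring_scope.

(* Norm of X_{2/a}, valued in the extended reals so that it is defined for
   every function. *)
Definition wnorm (R : realType) (a : R) (f : R -> R) : \bar R :=
  ereal_sup (range (fun t : R => (expR (2 * t / a) * `|f t|)%:E)).

Definition wspace (R : realType) (a : R) : set (R -> R) :=
  [set f | continuous f /\ (wnorm a f < +oo)%E].

Definition delay_shift (R : realType) (a : R) (f : R -> R) : R -> R :=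
  fun t => f (t - a).

Definition tail_op (R : realType) (g : R -> R) : R -> R :=
  fun t => (\int[lebesgue_measure]_(u in `[t, +oo[) ((u - t) * g u))%R.

Definition Phi_term (R : realType) (a b : R) (j : nat) : R -> R :=
  iter j (fun f => tail_op (fun t => \1_(~` `[a, b]) t * delay_shift a f t))
    (tail_op \1_(`[a, b])).

(* Sum of the series in X_{2/a}; the value is meaningful only when the series
   converges there, which holds for 0 < a < 2/e and a <= b. *)
Definition Phi (R : realType) (a b : R) : R -> R :=
  xget (fun=> 0) [set F | wspace a F /\
    wnorm a (fun t => F t - \sum_(j < n) Phi_term a b j t) @[n --> \oo]
      --> 0%E].

Definition Eval (R : realType) (a b : R) : R := Phi a b 0.

(* Meaningful only on [0, 2/e]; the last branch is the definite description
   of the unique b in (a, sqrt 2) with Eval a b = 1. *)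
Definition beta (R : realType) (a : R) : R :=
  if a == 0 then Num.sqrt 2
  else if a == 2 / expR 1 then 2 / expR 1
  else xget 0 [set b : R | a < b < Num.sqrt 2 /\ Eval a b = 1].

Definition abs_continuous (R : realType) (c d : R) (f : R -> R) : Prop :=
  forall eps : R, 0 < eps -> exists2 delta : R, 0 < delta &
    forall (n : nat) (u v : 'I_n -> R),
      (forall i, c <= u i /\ u i <= v i /\ v i <= d) ->
      trivIset setT (fun i => [set` `]u i, v i[]) ->
      \sum_(i < n) (v i - u i) < delta ->
      \sum_(i < n) `|f (v i) - f (u i)| < eps.

(* Derivative along D: one-sided at an endpoint of an interval D. *)
Definition has_deriv_within (R : realType) (D : set R) (f : R -> R) (t l : R)
    : Prop :=
  (f s - f t) / (s - t) @[s --> within D t^'] --> l.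

(* x : R -> R is only constrained on its domain J; its values outside J are
   irrelevant. *)
Definition solution (R : realType) (tau : R -> R) (t0 : R) (J : set R)
    (x : R -> R) : Prop :=
  [/\ is_interval J,
      `[t0, +oo[ `<=` J,
      tau @` `[t0, +oo[ `<=` J,
      {within J, continuous x}
    & exists y : R -> R,
      [/\ forall t, t0 <= t -> has_deriv_within `[t0, +oo[ x t (y t),
          {within `[t0, +oo[, continuous y},
          forall c d, t0 <= c -> c <= d -> abs_continuous c d y
        & {ae @lebesgue_measure R, forall t, t0 <= t ->
             is_derive t 1 y (x (tau t))}]].

(* Main.v *)
Require Import Defs.
From mathcomp Require Import all_boot all_order all_algebra.
From mathcomp Require Import all_classical all_reals all_analysis.
From mathcomp Require Import measurable_realfun ring lra.
Set Implicit Arguments.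
Unset Strict Implicit.
Unset Printing Implicit Defensive.
Import Order.TTheory GRing.Theory Num.Theory.
Import numFieldNormedType.Exports.

Local Open Scope classical_set_scope.
Local Open Scope ring_scope.

(** If x is positive, decreasing and tends to 0 then x'' = x o tau says that
    x = T(x o tau), where T g (t) is the integral of (u - t) g(u) over
    [t, oo[.  The operator w |-> T(w o tau) is monotone, so solutions come
    from supersolutions by a fixed-point argument.  There are three cases.

    If b = a, the delay is constant and x = exp(- m t), where m = exp(m a / 2)
    is solvable because a <= 2 / e ([constant_delay_realized]).

    If a = 0 < b <= sqrt 2, take tau constant equal to t_n on
    [t_n, t_(n+1)[, with t_(n+1) - t_n = b_n < b and b_n --> b.  The solution
    is a parabola on each interval, and the parabolas fit together to a
    positive solution because b_n ^ 2 < 2 ([quadratic_data],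
    [vanishing_delay_realized]).

    If 0 < a < b <= be, where be = beta a, the function F = Phi_(a, be)
    satisfies F = T(F o sigma) for the delay sigma(u) = u - a outside [a, be]
    and sigma = 0 on [a, be]; this uses F 0 = 1, which is the equation defining
    beta ([Phi_profile]).  So F is a solution on the line for a delay with a
    single stretch along which the delay grows from a to be.  In the weight
    exp(2 t / a) the function F tends to 0 at both ends: it passes from the
    slow to the fast of the two exponential rates of x''(t) = x(t - a), and
    after such a stretch nothing would be left for a second one.  But if the
    stretch is cut down to [a, p] with p < be, then F becomes a supersolution
    with some room to spare: the value on the stretch may be raised from 1 to
    1 + eps ([stretch_room]).  Now place stretches [t_n + a, t_n + b_n], with
    b_n < b and b_n --> b, at points t_n so far apart that, at t_n, the n-th
    term dominates the sum v of all exp(- 2 t_n / a) F(t - t_n) up to the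
    factor 1 + eps_n ([sparse_times], [superposition_node]).  Then v is a
    supersolution for the delay with all these stretches, and a strictly
    positive solution lies below it ([solution_of_supersolution],
    [stretched_delay_realized]).  Positivity comes from the delay: an initial
    piece of x is prescribed, and since tau(u) <= u - a a first zero s would
    force x(tau(u)) = 0 at points tau(u) < s. *)

(** * Solutions from slope estimates *)

Section slopes.
Variable R : realType.
Implicit Types (x y h tau f : R -> R) (J : set R).

Lemma lipschitz_abs_continuous f (K c d : R) :
  (forall s t, c <= s -> s <= t -> t <= d -> `|f t - f s| <= K * (t - s)) ->
  abs_continuous c d f.
Proof.
move=> fK e e0; exists (e / (`|K| + 1)).
  by rewrite divr_gt0// ltr_wpDl.
move=> n u v uv _ suv.
have K1 : 0 < `|K| + 1 by rewrite ltr_wpDl.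
apply: (@le_lt_trans _ _ ((`|K| + 1) * \sum_(i < n) (v i - u i))); last first.
  by rewrite mulrC -ltr_pdivlMr.
rewrite mulr_sumr; apply: ler_sum => i _.
have [cu [uvi vd]] := uv i.
apply: le_trans (fK _ _ cu uvi vd) _.
rewrite ler_wpM2r ?subr_ge0//.
by rewrite (le_trans (ler_norm K))// lerDl.
Qed.

Lemma lipschitz_within_continuous J f (K : R) :
  (forall s t, J s -> J t -> s <= t -> `|f t - f s| <= K * (t - s)) ->
  {within J, continuous f}.
Proof.
move=> fK; apply/subspace_continuousP => t Jt.
apply/cvgrPdist_le => e e0.
have K1 : 0 < `|K| + 1 by rewrite ltr_wpDl.
have : \forall s \near t, `|t - s| <= e / (`|K| + 1).
  have := @cvgr_dist_le R R^o R (nbhs t) _ id t cvg_id.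
  by apply; rewrite divr_gt0.
rewrite /within/=; apply: filterS => s ts Js.
have est : `|f t - f s| <= (`|K| + 1) * `|t - s|.
  wlog st : s t Js Jt {ts fK} fK / s <= t => [hw|].
    have [st|/ltW st] := leP s t; first exact: hw.
    by rewrite distrC (distrC t); apply: hw.
  apply: le_trans (fK _ _ Js Jt st) _.
  rewrite [`|t - s|]ger0_norm ?subr_ge0// ler_wpM2r ?subr_ge0//.
  by rewrite (le_trans (ler_norm K))// lerDl.
by apply: le_trans est _; rewrite mulrC -ler_pdivlMr.
Qed.

(** The one-sided limits of - h exist everywhere, and monotonicity makes both
    equal to - h t as soon as they agree; so h can only fail to be continuous
    at a jump, and jumps are countable. *)
Lemma nonincreasing_discontinuities_countable h :
  nonincreasing_fun h ->
  countable [set t : R | ~ {for t, continuous h}].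
Proof.
move=> hni.
have ndg : {homo (\- h) : s t / s <= t} by move=> s t st; rewrite lerN2 hni.
pose D (n : nat) := [set t : R | (t \in `]- n%:R, n%:R[) /\
  discontinuity (\- h) t].
have Dc : countable (\bigcup_n D n).
  apply: bigcup_countable => // n _.
  by apply: discontinuity_countable => s t _ _; exact: ndg.
apply: sub_countable Dc; apply: subset_card_le => t /= ht.
apply: contrapT => nt; apply: ht.
have cR : cvg (- h s @[s --> t^'+]).
  apply: nondecreasing_at_right_is_cvgr.
    by near=> v => r s _ _; exact: ndg.
  near=> v; exists (- h t) => _ [s /= + <-].
  by rewrite in_itv/= => /andP[/ltW ts _]; exact: ndg.
have cL : cvg (- h s @[s --> t^'-]).
  apply: nondecreasing_at_left_is_cvgr.
    by near=> v => r s _ _; exact: ndg.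
  near=> v; exists (- h t) => _ [s /= + <-].
  by rewrite in_itv/= => /andP[_ /ltW ts]; exact: ndg.
have lr : lim (- h s @[s --> t^'-]) = lim (- h s @[s --> t^'+]).
  apply: contrapT => /eqP lr; apply: nt; exists (Num.truncn `|t|).+1 => //; split.
    rewrite in_itv/= -ltr_norml; exact: truncnS_gt.
  by split.
have lt : lim (- h s @[s --> t^'-]) = - h t.
  apply/eqP; rewrite eq_le; apply/andP; split.
    apply: limr_le => //; near=> s; apply: ndg.
    by near: s; exact: nbhs_left_le.
  rewrite lr; apply: limr_ge => //; near=> s; apply: ndg.
  by near: s; exact: nbhs_right_ge.
have cmh : - h s @[s --> t] --> - h t.
  apply/left_right_continuousP; split.
    by rewrite -[X in _ --> X]lt.
  by rewrite -[X in _ --> X]lt lr.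
have : - - h s @[s --> t] --> - - h t by exact: cvgN.
by rewrite opprK; under eq_fun do rewrite opprK.
Unshelve. all: by end_near. Qed.


(** Monotonicity of h squeezes the difference quotients of y at t between h t
    and nearby values of h. *)
Lemma monotone_slope_is_derive y h (t0 t : R) :
  nonincreasing_fun h ->
  (forall s u, t0 <= s -> s <= u ->
    h u * (u - s) <= y u - y s <= h s * (u - s)) ->
  t0 < t -> {for t, continuous h} -> is_derive t 1 y (h t).
Proof.
move=> hni yh t0t ch.
have cv : e^-1 *: ((y \o shift t) (e *: 1) - y t) @[e --> 0^'] --> h t.
  apply/cvgrPdist_le => e e0.
  have [d /= d0 dP] : \forall s \near t, `|h t - h s| <= e.
    by move/cvgrPdist_le : ch; exact.
  have [d' /= d'0 d'P] : \forall s \near t, t0 < s by exact: lt_nbhsr.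
  exists (Num.min d d') => /=; first by rewrite lt_min d0.
  move=> s /= + s0; rewrite sub0r normrN lt_min => /andP[sd sd'].
  have ts : ball t d (s + t) by rewrite /ball/= opprD addrC addrNK normrN.
  have ts' : ball t d' (s + t) by rewrite /ball/= opprD addrC addrNK normrN.
  have := dP _ ts; have := d'P _ ts' => /= t0s.
  rewrite [s *: 1]mulr1 [_ *: _]mulrC.
  have [sp|sn|/esym/eqP] := ltgtP 0 s; last by rewrite (negbTE s0).
    have tst : t <= s + t by rewrite lerDr ltW.
    have /andP[h1 h2] := yh t (s + t) (ltW t0t) tst.
    rewrite addrK in h1 h2.
    have k1 : h (s + t) <= (y (s + t) - y t) / s by rewrite ler_pdivlMr.
    have k2 : (y (s + t) - y t) / s <= h t by rewrite ler_pdivrMr.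
    rewrite !ger0_norm ?subr_ge0//; last exact: le_trans k1 k2.
    by apply: le_trans; rewrite lerD2l lerN2.
  have stt : s + t <= t by rewrite gerDr ltW.
  have /andP[h1 h2] := yh (s + t) t (ltW t0s) stt.
  have tst : t - (s + t) = - s by rewrite opprD addrCA subrr addr0.
  rewrite tst in h1 h2.
  have k1 : h t <= (y (s + t) - y t) / s.
    by rewrite -[leRHS]mulrNN -invrN opprB ler_pdivlMr ?oppr_gt0.
  have k2 : (y (s + t) - y t) / s <= h (s + t).
    by rewrite -[leLHS]mulrNN -invrN opprB ler_pdivrMr ?oppr_gt0.
  rewrite !ler0_norm ?subr_le0//; last exact: le_trans k1 k2.
  by apply: le_trans; rewrite !opprB lerD2r.
split; first by apply/cvg_ex; exists (h t).
by apply/cvg_lim.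
Qed.

(** The hypotheses say that y is a primitive of x o tau and that x is a
    primitive of y, in the form of inequalities that can be added over adjacent
    intervals. They make y Lipschitz, hence absolutely continuous; and y has
    derivative x (tau t) where the nonincreasing function x o tau is
    continuous, that is off a countable set. *)
Lemma solution_of_slopes tau x y (t0 : R) J :
  is_interval J -> `[t0, +oo[ `<=` J -> tau @` `[t0, +oo[ `<=` J ->
  {within J, continuous x} ->
  nonincreasing_fun (x \o tau) ->
  (forall t, t0 <= t -> 0 <= x (tau t)) ->
  (forall s t, t0 <= s -> s <= t ->
    x (tau t) * (t - s) <= y t - y s <= x (tau s) * (t - s)) ->
  (forall s t, t0 <= s -> s <= t ->
    y s * (t - s) <= x t - x s <= y t * (t - s)) ->
  solution tau t0 J x.
Proof.
move=> iJ J0 Jtau cx hni h0 yh xy; split => //.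
have yK s t : t0 <= s -> s <= t -> `|y t - y s| <= x (tau t0) * (t - s).
  move=> t0s st; have /andP[y1 y2] := yh s t t0s st.
  rewrite ger0_norm; last first.
    by apply: le_trans y1; rewrite mulr_ge0 ?subr_ge0// h0// (le_trans t0s).
  by apply: le_trans y2 _; rewrite ler_wpM2r ?subr_ge0//; exact: hni.
exists y; split.
- move=> t t0t; apply/cvgrPdist_le => e e0.
  pose K := x (tau t0) + 1.
  have K0 : 0 < K by rewrite ltr_wpDl// h0.
  rewrite /within/= /dnbhs /within/=.
  exists (e / K) => /=; first by rewrite divr_gt0.
  move=> s /= ts s_t; rewrite in_itv/= andbT => t0s.
  have est : `|y t - (x s - x t) / (s - t)| <= x (tau t0) * `|s - t|.
    have [ts'|st|/esym/eqP] := ltgtP t s; last by rewrite (negbTE s_t).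
      have /andP[h1 h2] := xy t s t0t (ltW ts').
      have st0 : 0 < s - t by rewrite subr_gt0.
      have k1 : y t <= (x s - x t) / (s - t) by rewrite ler_pdivlMr.
      have k2 : (x s - x t) / (s - t) <= y s by rewrite ler_pdivrMr.
      have := yK t s t0t (ltW ts'); rewrite [`|s - t|]gtr0_norm//.
      rewrite ger0_norm ?subr_ge0 ?(le_trans k1)// ler0_norm ?subr_le0//.
      by apply: le_trans; rewrite opprB lerD2r.
    have /andP[h1 h2] := xy s t t0s (ltW st).
    have st0 : 0 < t - s by rewrite subr_gt0.
    have -> : (x s - x t) / (s - t) = (x t - x s) / (t - s).
      by rewrite -mulrNN -invrN !opprB.
    have k1 : y s <= (x t - x s) / (t - s) by rewrite ler_pdivlMr.
    have k2 : (x t - x s) / (t - s) <= y t by rewrite ler_pdivrMr.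
    have := yK s t t0s (ltW st); rewrite (distrC s) [`|t - s|]gtr0_norm//.
    rewrite ger0_norm ?subr_ge0 ?(le_trans k1)// ger0_norm ?subr_ge0//.
    by apply: le_trans; rewrite lerD2l lerN2.
  apply: le_trans est _.
  have : `|s - t| <= e / K by rewrite distrC ltW.
  rewrite ler_pdivlMr// => /(le_trans _); apply.
  by rewrite mulrC ler_wpM2l// lerDl.
- apply: (@lipschitz_within_continuous _ _ (x (tau t0))) => s t /=.
  by rewrite !in_itv/= !andbT => t0s _ st; exact: yK.
- move=> c d t0c cd; apply: (@lipschitz_abs_continuous _ (x (tau t0))) => s t.
  by move=> cs st td; apply: yK => //; exact: le_trans cs.
- have neg A : countable A -> (@lebesgue_measure R).-negligible A.
    move=> cA; exists A; split => //; last exact: countable_lebesgue_measure0.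
    by apply: countable_measurable => // t; exact: measurable_set1.
  have nD : (@lebesgue_measure R).-negligible
      ([set t | ~ {for t, continuous (x \o tau)}] `|` [set t0]).
    apply: negligibleU; apply: neg => //.
    exact: nonincreasing_discontinuities_countable.
  apply: negligibleS nD.
  move=> t /= nt; apply: contrapT => /not_orP[/contrapT ct t_t0]; apply: nt.
  rewrite le_eqVlt => /predU1P[/esym //|t0t].
  exact: (@monotone_slope_is_derive y (x \o tau) t0).
Qed.

End slopes.

(** * The operator T *)

Section tail.
Variable R : realType.
Implicit Types (g : R -> \bar R) (s t u c : R).
Local Notation mu := (@lebesgue_measure R).
Local Open Scope ereal_scope.

(** The operator T, with values in the extended reals so that monotone limits
    are unconditional. The weight max(0, u - t) replaces the domain [t, oo[,
    which lets different points t and translates of g be compared under one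
    integral. *)
Definition tail g t : \bar R := \int[mu]_u ((Num.max 0 (u - t))%:E * g u).

Lemma tail_weight_ge0 t u : 0 <= (Num.max 0 (u - t))%:E :> \bar R.
Proof. by rewrite lee_fin le_max lexx. Qed.

Lemma measurable_tail_weight t :
  measurable_fun [set: R] (fun u => (Num.max 0 (u - t))%:E).
Proof.
apply/measurable_EFinP; apply: measurable_maxr; first exact: measurable_cst.
by apply: measurable_funB => //; exact: measurable_id.
Qed.
Local Hint Resolve tail_weight_ge0 measurable_tail_weight : core.

Lemma weighted_measurable g t : measurable_fun [set: R] g ->
  measurable_fun [set: R] (fun u => (Num.max 0 (u - t))%:E * g u).
Proof. exact: emeasurable_funM. Qed.

Lemma tail_ge0 g t : (forall u, 0 <= g u) -> 0 <= tail g t.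
Proof. by move=> g0; apply: integral_ge0 => u _; exact: mule_ge0. Qed.

Lemma le_tail g g' t : (forall u, 0 <= g u) ->
  measurable_fun [set: R] g -> measurable_fun [set: R] g' ->
  (forall u, (t < u)%R -> g u <= g' u) -> tail g t <= tail g' t.
Proof.
move=> g0 mg mg' gg'; apply: ge0_le_integral => //.
- by move=> u _; exact: mule_ge0.
- exact: weighted_measurable.
- exact: weighted_measurable.
- move=> u _; have [tu|ut] := ltP t u; first by rewrite lee_wpmul2l// gg'.
  by rewrite max_l ?subr_le0// !mul0e.
Qed.

Lemma eq_tail g g' t : (forall u, (t < u)%R -> g u = g' u) ->
  tail g t = tail g' t.
Proof.
move=> gg'; apply: eq_integral => u _.
have [tu|ut] := ltP t u; first by rewrite gg'.
by rewrite max_l ?subr_le0// !mul0e.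
Qed.

Lemma tail_series (g : nat -> R -> \bar R) t :
  (forall n u, 0 <= g n u) -> (forall n, measurable_fun [set: R] (g n)) ->
  tail (fun u => \sum_(n <oo) g n u) t = \sum_(n <oo) tail (g n) t.
Proof.
move=> g0 mg; rewrite /tail -integral_nneseries//; last 2 first.
- by move=> n; exact: weighted_measurable.
- by move=> n u _; exact: mule_ge0.
by apply: eq_integral => u _; rewrite nneseriesZl.
Qed.

Lemma tailD g g' t : (forall u, 0 <= g u) -> (forall u, 0 <= g' u) ->
  measurable_fun [set: R] g -> measurable_fun [set: R] g' ->
  tail (fun u => g u + g' u) t = tail g t + tail g' t.
Proof.
move=> g0 g'0 mg mg'; rewrite /tail -ge0_integralD//; last 4 first.
- by move=> u _; exact: mule_ge0.
- exact: weighted_measurable.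
- by move=> u _; exact: mule_ge0.
- exact: weighted_measurable.
by apply: eq_integral => u _; rewrite ge0_muleDr.
Qed.

Lemma tailZl c g t : (0 <= c)%R -> (forall u, 0 <= g u) ->
  measurable_fun [set: R] g ->
  tail (fun u => c%:E * g u) t = c%:E * tail g t.
Proof.
move=> c0 g0 mg; rewrite /tail -ge0_integralZl_EFin//; last 2 first.
- by move=> u _; exact: mule_ge0.
- exact: weighted_measurable.
by apply: eq_integral => u _; rewrite muleCA.
Qed.

(** Lebesgue measure and its image under a translation agree on half-open
    intervals, hence on all measurable sets. *)
Lemma integral_translate g c : (forall u, 0 <= g u) ->
  measurable_fun [set: R] g -> \int[mu]_u g (u - c)%R = \int[mu]_u g u.
Proof.
move=> g0 mg.
pose phi : R -> measurableTypeR R := fun u => (u - c)%R.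
have mphi : measurable_fun [set: R] phi.
  by apply: measurable_funB => //; exact: measurable_id.
have muE A : measurable A -> mu A = pushforward mu phi A.
  apply: lebesgue_measure_unique => //= _ [[a b]] _ <-.
  rewrite /pushforward.
  have -> : phi @^-1` `]a, b] = `](a + c)%R, (b + c)%R]%classic.
    by apply/seteqP; split=> u /=; rewrite !in_itv/= /phi ltrBrDr lerBlDr.
  rewrite !lebesgue_measure_itv/= !lte_fin ltrD2r.
  by case: ifP => // _; rewrite -!EFinB opprD addrACA subrr addr0.
have -> : \int[mu]_u g u = \int[pushforward mu phi]_u g u.
  by apply: eq_measure_integral => //= A mA _; exact: muE.
by rewrite ge0_integral_pushforward.
Qed.

Lemma tail_translate g c t : (forall u, 0 <= g u) ->
  measurable_fun [set: R] g ->
  tail (fun u => g (u - c)%R) t = tail g (t - c).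
Proof.
move=> g0 mg; rewrite /tail.
rewrite -(@integral_translate (fun u => (Num.max 0 (u - (t - c)))%:E * g u) c).
- by apply: eq_integral => u _; rewrite opprB addrA subrK.
- by move=> u; exact: mule_ge0.
- exact: weighted_measurable.
Qed.

Lemma le_tail_point g s t : (forall u, 0 <= g u) ->
  measurable_fun [set: R] g -> (s <= t)%R -> tail g t <= tail g s.
Proof.
move=> g0 mg st; apply: ge0_le_integral => //.
- by move=> u _; exact: mule_ge0.
- exact: weighted_measurable.
- exact: weighted_measurable.
- move=> u _; rewrite lee_wpmul2r// lee_fin ge_max !le_max lexx/=.
  by rewrite lerD2l lerN2 st orbT.
Qed.

(** From t back to s, the weight grows by t - s on [t, oo[ and by at most t - s
    on [s, oo[; the two resulting bounds identify minus the integral of g over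
    [t, oo[ as the derivative of T g. *)
Lemma tail_drop g s t : (forall u, 0 <= g u) ->
  measurable_fun [set: R] g -> (s <= t)%R ->
  tail g t + (t - s)%:E * \int[mu]_(u in `[t, +oo[) g u <= tail g s.
Proof.
move=> g0 mg st; rewrite integral_mkcond.
have ts0 : (0 <= t - s)%R by rewrite subr_ge0.
have r0 u : 0 <= (g \_ `[t, +oo[%classic) u by exact: erestrict_ge0.
have mr : measurable_fun [set: R] (g \_ `[t, +oo[%classic).
  by apply/(measurable_restrictT _ _).1 => //; exact: measurable_funTS.
have tr0 u : 0 <= (t - s)%:E * (g \_ `[t, +oo[%classic) u by exact: mule_ge0.
have mtr : measurable_fun [set: R]
    (fun u => (t - s)%:E * (g \_ `[t, +oo[%classic) u).
  exact: emeasurable_funM.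
rewrite -ge0_integralZl_EFin// /tail -ge0_integralD//; last 2 first.
- by move=> u _; exact: mule_ge0.
- exact: weighted_measurable.
apply: ge0_le_integral => //.
- by move=> u _; rewrite adde_ge0 ?mule_ge0.
- by apply: emeasurable_funD => //; exact: weighted_measurable.
- exact: weighted_measurable.
move=> u _; rewrite /patch mem_setE in_itv/= andbT; case: ifPn => [tu|].
  rewrite -ge0_muleDl// lee_wpmul2r// -EFinD lee_fin.
  rewrite !max_r ?subr_ge0 ?(le_trans st)//.
  by rewrite addrA subrK.
rewrite -ltNge => ut; rewrite mule0 adde0 lee_wpmul2r// lee_fin.
by rewrite [X in (X <= _)%R]max_l ?le_max ?lexx// subr_le0 ltW.
Qed.

Lemma tail_rise g s t : (forall u, 0 <= g u) ->
  measurable_fun [set: R] g -> (s <= t)%R ->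
  tail g s <= tail g t + (t - s)%:E * \int[mu]_(u in `[s, +oo[) g u.
Proof.
move=> g0 mg st; rewrite integral_mkcond.
have ts0 : (0 <= t - s)%R by rewrite subr_ge0.
have r0 u : 0 <= (g \_ `[s, +oo[%classic) u by exact: erestrict_ge0.
have mr : measurable_fun [set: R] (g \_ `[s, +oo[%classic).
  by apply/(measurable_restrictT _ _).1 => //; exact: measurable_funTS.
have tr0 u : 0 <= (t - s)%:E * (g \_ `[s, +oo[%classic) u by exact: mule_ge0.
have mtr : measurable_fun [set: R]
    (fun u => (t - s)%:E * (g \_ `[s, +oo[%classic) u).
  exact: emeasurable_funM.
rewrite -ge0_integralZl_EFin// /tail -ge0_integralD//; last 2 first.
- by move=> u _; exact: mule_ge0.
- exact: weighted_measurable.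
apply: ge0_le_integral => //.
- by move=> u _; exact: mule_ge0.
- exact: weighted_measurable.
- by apply: emeasurable_funD => //; exact: weighted_measurable.
move=> u _; rewrite /patch mem_setE in_itv/= andbT; case: ifPn => [su|].
  rewrite -ge0_muleDl// lee_wpmul2r// -EFinD lee_fin.
  by rewrite max_r ?subr_ge0// -lerBlDr opprB addrA subrK le_max lexx orbT.
rewrite -ltNge => us; rewrite mule0 adde0 lee_wpmul2r// lee_fin.
by rewrite [X in (X <= _)%R]max_l ?le_max ?lexx// subr_le0 ltW.
Qed.

Lemma tail_opE (g : R -> R) t :
  tail_op g t = fine (tail (EFin \o g) t).
Proof.
rewrite /tail_op /Rintegral integral_mkcond; congr fine.
apply: eq_integral => u _ /=; rewrite /patch mem_setE in_itv/= andbT -EFinM.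
case: ifPn => [tu|]; first by rewrite max_r ?subr_ge0.
by rewrite -ltNge => ut; rewrite max_l ?mul0r// subr_le0 ltW.
Qed.

End tail.

(** * Estimates for T *)

Section tail_estimates.
Variable R : realType.
Implicit Types (s t u c k p q r : R) (h : R -> R).
Local Notation mu := (@lebesgue_measure R).

Lemma integral_exp_tail k t : 0 < k ->
  (\int[mu]_(u in `[t, +oo[) (expR (- k * u))%:E = (expR (- k * t) / k)%:E)%E.
Proof.
move=> k0.
have cE : continuous (fun u : R => expR (- k * u)).
  move=> u; apply: continuous_comp; last exact: continuous_expR.
  exact: mulrl_continuous.
have dE u : is_derive u 1 (fun u : R => - (expR (- k * u) / k)) (expR (- k * u)).
  apply: is_derive_eq; rewrite /GRing.scale/=.
  have k0' : k != 0 by rewrite gt_eqF.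
  by field.
rewrite (@ge0_continuous_FTC2y _ _ (fun u => - (expR (- k * u) / k)) _ 0).
- by rewrite sub0e -EFinN opprK.
- by move=> u _; exact: expR_ge0.
- exact: continuous_subspaceT.
- rewrite -oppr0; apply: cvgN; rewrite -(mul0r k^-1); apply: cvgM; last exact: cvg_cst.
  rewrite (_ : (fun u => expR (- k * u)) =
               (fun z => expR (- z)) \o (fun z => k * z)); last first.
    by apply/funext => u /=; rewrite mulNr.
  apply: (@cvg_comp _ _ _ _ _ _ (pinfty_nbhs R)); last exact: cvgr_expR.
  exact: gt0_cvgMry.
- by move=> u _; have [] := dE u.
- apply: cvg_at_right_filter; apply: cvgN; apply: cvgM; [exact: cE|exact: cvg_cst].
- by move=> u _; rewrite derive1E; have [_ ->] := dE u.
Qed.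

(** Since u - t <= (2 / k) exp(k (u - t) / 2), half of the rate absorbs the
    weight. *)
Lemma tail_exp_le k t : 0 < k ->
  (tail (fun u => (expR (- k * u))%:E) t <= (4 / k ^+ 2 * expR (- k * t))%:E)%E.
Proof.
move=> k0; have k0' : k != 0 by rewrite gt_eqF.
have k20 : 0 < k / 2 by rewrite divr_gt0.
have mE (j : R) : measurable_fun [set: R] (fun u : R => (expR (- j * u))%:E).
  apply/measurable_EFinP; apply: continuous_measurable_fun => u.
  apply: continuous_comp; last exact: continuous_expR.
  exact: mulrl_continuous.
have -> : ((4 / k ^+ 2 * expR (- k * t))%:E =
    (2 / k * expR (- (k / 2) * t))%:E *
    \int[mu]_(u in `[t, +oo[) (expR (- (k / 2) * u))%:E)%E.
  rewrite integral_exp_tail// -EFinM; congr EFin.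
  have -> : - k * t = - (k / 2) * t + - (k / 2) * t by field.
  by rewrite expRD; field.
rewrite integral_mkcond.
have r0 u : (0 <= ((fun u => (expR (- (k / 2) * u))%:E) \_ `[t, +oo[%classic) u)%E.
  by apply: erestrict_ge0 => v _; rewrite lee_fin expR_ge0.
have mr : measurable_fun [set: R]
    ((fun u => (expR (- (k / 2) * u))%:E) \_ `[t, +oo[%classic).
  by apply/(measurable_restrictT _ _).1 => //; exact: measurable_funTS.
have c0 : 0 <= 2 / k * expR (- (k / 2) * t).
  by rewrite mulr_ge0 ?expR_ge0// divr_ge0// ltW.
rewrite -ge0_integralZl_EFin//; apply: ge0_le_integral => //.
- by move=> u _; rewrite mule_ge0 ?tail_weight_ge0// lee_fin expR_ge0.
- by apply: weighted_measurable.
- by apply: emeasurable_funM.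
move=> u _; rewrite /patch mem_setE in_itv/= andbT; case: ifPn => [tu|].
  rewrite -!EFinM lee_fin max_r ?subr_ge0// -[leRHS]mulrA -expRD.
  have -> : - k * u = - (k / 2 * (u - t)) + (- (k / 2) * t + - (k / 2) * u).
    by field.
  rewrite [X in _ * X <= _]expRD [leLHS]mulrA.
  apply: ler_wpM2r; first exact: expR_ge0.
  rewrite expRN ler_pdivrMr ?expR_gt0//.
  have -> : u - t = 2 / k * (k / 2 * (u - t)) by field.
  rewrite ler_wpM2l ?divr_ge0 ?ltW//.
  have -> : k / 2 * (2 / k * (k / 2 * (u - t))) = k / 2 * (u - t) by field.
  by have := expR_ge1Dx (k / 2 * (u - t)); lra.
by rewrite -ltNge => ut; rewrite max_l ?mul0e ?mule0// subr_le0 ltW.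
Qed.

Lemma measurable_indicE (A : set R) : measurable A ->
  measurable_fun [set: R] (fun u => (\1_A u : R)%:E).
Proof. by move=> mA; apply/measurable_EFinP; exact: measurable_indic. Qed.

Lemma integral_cst_indic c (A : set R) : 0 <= c -> measurable A ->
  (\int[mu]_u (c%:E * (\1_A u)%:E) = c%:E * mu A)%E.
Proof.
move=> c0 mA; rewrite ge0_integralZl_EFin//; last exact: measurable_indicE.
by rewrite integral_indic// setIT.
Qed.

(** Mass on [p, q] contributes at most as if it sat at q, and mass on ]q, r] at
    least as if it sat at q. So mass on the left of q can be traded for the
    same amount of mass on the right of q without decreasing T at any point. *)
Lemma tail_indic_le p q t : p <= q ->
  (tail (fun u => (\1_`[p, q] u)%:E) t <= ((q - p) * Num.max 0 (q - t))%:E)%E.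
Proof.
move=> pq.
have w0 : 0 <= Num.max 0 (q - t) by rewrite le_max lexx.
have -> : (((q - p) * Num.max 0 (q - t))%:E =
    \int[mu]_u ((Num.max 0 (q - t))%:E * (\1_`[p, q] u)%:E))%E.
  rewrite integral_cst_indic// lebesgue_measure_itv/= lte_fin mulrC EFinM.
  move: pq; rewrite le_eqVlt => /predU1P[->|->]; last by rewrite -EFinB.
  by rewrite ltxx subrr.
apply: ge0_le_integral => //.
- by move=> u _; rewrite mule_ge0 ?tail_weight_ge0// lee_fin.
- by apply: weighted_measurable; exact: measurable_indicE.
- by apply: emeasurable_funM => //; exact: measurable_indicE.
move=> u _; rewrite indicE mem_setE in_itv/=.
case: (boolP (_ && _)) => [/andP[_ uq]|_]; last by rewrite mulr0n !mule0.
by rewrite mulr1n !mule1 lee_fin ge_max !le_max lexx/= lerD2r uq orbT.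
Qed.

Lemma tail_indic_ge q r t : q <= r ->
  (((r - q) * Num.max 0 (q - t))%:E <= tail (fun u => (\1_`]q, r] u)%:E) t)%E.
Proof.
move=> qr.
have w0 : 0 <= Num.max 0 (q - t) by rewrite le_max lexx.
have -> : (((r - q) * Num.max 0 (q - t))%:E =
    \int[mu]_u ((Num.max 0 (q - t))%:E * (\1_`]q, r] u)%:E))%E.
  rewrite integral_cst_indic// lebesgue_measure_itv/= lte_fin mulrC EFinM.
  move: qr; rewrite le_eqVlt => /predU1P[->|->]; last by rewrite -EFinB.
  by rewrite ltxx subrr.
apply: ge0_le_integral => //.
- by move=> u _; rewrite mule_ge0// lee_fin.
- by apply: emeasurable_funM => //; exact: measurable_indicE.
- by apply: weighted_measurable; exact: measurable_indicE.
move=> u _; rewrite indicE mem_setE in_itv/=.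
case: (boolP (_ && _)) => [/andP[qu _]|_]; last by rewrite mulr0n !mule0.
by rewrite mulr1n !mule1 lee_fin ge_max !le_max lexx/= lerD2r (ltW qu) orbT.
Qed.

(** Half of ]s, u] is given away, so that the weight is bounded below on the
    rest. *)
Lemma tail_gt0 h s u c : (forall v, 0 <= h v) ->
  measurable_fun [set: R] (EFin \o h) -> s < u -> 0 < c ->
  (forall v, s < v -> v <= u -> c <= h v) -> (0 < tail (EFin \o h) s)%E.
Proof.
move=> h0 mh su c0 hc.
pose m := (s + u) / 2.
have sm : s < m by rewrite /m; lra.
have mu' : m < u by rewrite /m; lra.
have : (tail (fun v => c%:E * (\1_`]m, u] v)%:E) s <= tail (EFin \o h) s)%E.
  apply: le_tail => //.
  - by move=> v; rewrite mule_ge0// lee_fin// ltW.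
  - by apply: emeasurable_funM => //; exact: measurable_indicE.
  move=> v sv; rewrite -EFinM lee_fin indicE mem_setE in_itv/=.
  by case: (boolP (_ && _)) => [/andP[_ vu]|_]; rewrite ?mulr1n ?mulr0n ?mulr1 ?mulr0// hc.
apply: lt_le_trans; rewrite tailZl ?ltW//; last exact: measurable_indicE.
apply: mule_gt0 => //; apply: lt_le_trans (tail_indic_ge _ (ltW mu')).
by rewrite lte_fin mulr_gt0 ?subr_gt0// lt_max subr_gt0 sm orbT.
Qed.

Lemma tail_slopes h t0 : nonincreasing_fun h -> (forall u, 0 <= h u) ->
  (tail (EFin \o h) t0 < +oo)%E ->
  exists y : R -> R, forall s t, t0 <= s -> s <= t ->
    (h t * (t - s) <= y t - y s <= h s * (t - s)) /\
    (y s * (t - s) <= fine (tail (EFin \o h) t) - fine (tail (EFin \o h) s)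
       <= y t * (t - s)).
Proof.
move=> hni h0 fint0.
have mh : measurable_fun [set: R] (EFin \o h).
  by apply/measurable_EFinP; exact: nonincreasing_measurable.
have eh0 u : (0 <= (EFin \o h) u)%E by rewrite lee_fin.
pose H t := (\int[mu]_(u in `[t, +oo[) (EFin \o h) u)%E.
have H0 t : (0 <= H t)%E by apply: integral_ge0.
have Hsplit s t : s <= t -> (H s = \int[mu]_(u in `[s, t[) (EFin \o h) u + H t)%E.
  move=> st; rewrite /H.
  have -> : `[s, +oo[%classic = `[s, t[%classic `|` `[t, +oo[%classic.
    apply/seteqP; split => u /=; rewrite !in_itv/= ?andbT.
      by move=> su; have [tu|ut] := leP t u; [right|left; rewrite su].
    by move=> [/andP[]//|]; exact: le_trans.
  rewrite ge0_integral_setU//.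
  - by apply: measurable_funTS.
  - apply/disj_set2P/seteqP; split => // u /= [].
    by rewrite !in_itv/= andbT => /andP[_ ut]; rewrite leNgt ut.
have step s t : s <= t -> ((h t * (t - s))%:E <=
    \int[mu]_(u in `[s, t[) (EFin \o h) u <= (h s * (t - s))%:E)%E.
  move=> st.
  have cst c : (\int[mu]_(u in `[s, t[) (cst c%:E) u = (c * (t - s))%:E)%E.
    rewrite integral_cst//= lebesgue_measure_itv/= lte_fin EFinM.
    move: st; rewrite le_eqVlt => /predU1P[->|->]; last by rewrite -EFinB.
    by rewrite ltxx subrr.
  rewrite -!cst; apply/andP; split; apply: ge0_le_integral => //.
  - by move=> u _; exact: eh0.
  - exact: measurable_funTS.
  - by move=> u /=; rewrite in_itv/= => /andP[_ /ltW ut]; rewrite lee_fin hni.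
  - exact: measurable_funTS.
  - by move=> u /=; rewrite in_itv/= => /andP[su _]; rewrite lee_fin hni.
(* Finiteness of T h at t0 bounds the integral of h over [t0 + 1, oo[, and
   monotonicity bounds the missing unit interval. *)
have Hfin1 : (H (t0 + 1)%R < +oo)%E.
  have t01 : t0 <= t0 + 1 by rewrite lerDl.
  have e1 : t0 + 1 - t0 = 1 by rewrite addrAC subrr add0r.
  have := tail_drop eh0 mh t01; rewrite e1 mul1e => le1.
  apply: le_lt_trans fint0; apply: le_trans le1.
  by rewrite leeDr// tail_ge0.
have Hfin t : t0 <= t -> H t \is a fin_num.
  move=> t0t; rewrite ge0_fin_numE//; apply: (@le_lt_trans _ _ (H t0)).
    by rewrite (Hsplit _ _ t0t) leeDr// integral_ge0.
  have t01 : t0 <= t0 + 1 by rewrite lerDl.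
  rewrite (Hsplit _ _ t01) lte_add_pinfty//.
  have /andP[_ s2] := step _ _ t01.
  by apply: le_lt_trans s2 _; rewrite ltry.
have Tfin t : t0 <= t -> tail (EFin \o h) t \is a fin_num.
  move=> t0t; rewrite ge0_fin_numE ?tail_ge0//.
  by apply: le_lt_trans fint0; exact: le_tail_point.
exists (fun t => - fine (H t)) => s t t0s st.
have t0t := le_trans t0s st.
have Hs := Hfin _ t0s; have Ht := Hfin _ t0t.
have Ts := Tfin _ t0s; have Tt := Tfin _ t0t.
have := Hsplit _ _ st; have := step _ _ st.
have := tail_drop eh0 mh st; have := tail_rise eh0 mh st.
rewrite -/(H t) -/(H s).
set I := (\int[mu]_(u in _) _)%E.
have I0 : (0 <= I)%E by apply: integral_ge0.
rewrite -(fineK Hs) -(fineK Ht) -(fineK Ts) -(fineK Tt) => r d /andP[i1 i2] e.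
have If : I \is a fin_num.
  by rewrite ge0_fin_numE//; apply: le_lt_trans i2 _; rewrite ltry.
move: r d i1 i2 e; rewrite -(fineK If) -!EFinM -!EFinD !lee_fin.
move=> r d i1 i2 [e]; split; apply/andP; split; rewrite /=; lra.
Qed.

End tail_estimates.

(** * From supersolutions to solutions *)

Section fixed_points.
Variables (R : realType) (T : Type).
Implicit Types (w : T -> R).

(** Knaster and Tarski: the pointwise supremum of all w with w <= A w is fixed.
    The class Q has to be stable under suprema; it keeps track of a property of
    the fixed point, such as monotonicity, which also provides the
    measurability that integral operators ask for. *)
Lemma monotone_fixed_point (Q : set (T -> R)) (V : T -> R)
    (A : (T -> R) -> T -> R) :
  let L := [set w | Q w /\ forall t, 0 <= w t <= V t] in
  (forall S, S `<=` L -> S !=set0 -> Q (fun t => sup [set w t | w in S])) ->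
  L (fun=> 0) ->
  (forall w, L w -> L (A w)) ->
  (forall w w', L w -> L w' -> (forall t, w t <= w' t) ->
     forall t, A w t <= A w' t) ->
  exists2 x, L x & forall t, A x t = x t.
Proof.
move=> L Qsup L0 AL Amono.
pose S := [set w | L w /\ forall t, w t <= A w t].
have SL : S `<=` L by move=> w [].
have S0 : S (fun=> 0).
  by split=> // t; have [_ /(_ t)/andP[]] := AL _ L0.
pose x t := sup [set w t | w in S].
have hs t : has_sup [set w t | w in S].
  split; first by exists 0, (fun=> 0).
  by exists (V t) => _ [w [[_ wV] _] <-]; have /andP[] := wV t.
have ubx w t : S w -> w t <= x t.
  by move=> Sw; apply: sup_upper_bound => //; exists w.
have Lx : L x.
  split; first by apply: Qsup => //; exists (fun=> 0).
  move=> t; rewrite (ubx _ _ S0)/=; apply: ge_sup; first exact: (hs t).1.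
  by move=> _ [w [[_ wV] _] <-]; have /andP[] := wV t.
have xA t : x t <= A x t.
  apply: ge_sup; first exact: (hs t).1.
  move=> _ [w Sw <-]; apply: le_trans (Sw.2 t) _.
  by apply: Amono => //; [exact: SL|move=> u; exact: ubx].
exists x => // t; apply/eqP; rewrite eq_le xA andbT.
by apply: ubx; split; [exact: AL|apply: Amono => //; exact: AL].
Qed.

End fixed_points.

Section supersolutions.
Variable R : realType.
Implicit Types (s t u k : R) (V tau x y : R -> R).

(** If y t >= 0, then y > 0 afterwards because its slope h is positive, and x
    would increase. *)
Lemma decreasing_of_slopes x y h (t0 : R) :
  (forall s t, t0 <= s -> s <= t -> x t <= x s) ->
  (forall t, t0 <= t -> 0 < h t) ->
  (forall s t, t0 <= s -> s <= t ->
    h t * (t - s) <= y t - y s <= h s * (t - s)) ->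
  (forall s t, t0 <= s -> s <= t ->
    y s * (t - s) <= x t - x s <= y t * (t - s)) ->
  forall s t, t0 <= s -> s < t -> x t < x s.
Proof.
move=> xni h0 hy hx s t t0s st.
have yneg : y t < 0.
  rewrite ltNge; apply/negP => y0.
  have t0t : t0 <= t by rewrite (le_trans t0s)// ltW.
  have t1 : t <= t + 1 by rewrite lerDl.
  have t2 : t + 1 <= t + 2 by rewrite lerD2l ler1n.
  have t01 := le_trans t0t t1.
  have /andP[+ _] := hy _ _ t0t t1; have /andP[+ _] := hx _ _ t01 t2.
  have := xni _ _ t01 t2; have := h0 _ t01; nra.
have /andP[_] := hx _ _ t0s (ltW st).
by move=> le1; rewrite -subr_lt0 (le_lt_trans le1)// nmulr_rlt0// subr_gt0.
Qed.

(** The solution is a fixed point of w |-> T(w o tau) on [T0, oo[, continued to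
    the left of T0 by a segment of slope - k. Without this forcing term the
    fixed point could be 0; with it x is positive on [0, T0[, and positivity
    propagates: at a first zero s >= T0, T(x o tau) would vanish at s although
    x o tau is positive on a right neighbourhood of s, where tau reaches back
    before s. The start condition keeps V a supersolution of the forced
    equation. Both V and the fixed point are extended to the whole line as
    nonincreasing functions. *)
Lemma solution_of_supersolution tau V (T0 k : R) :
  {homo tau : s t / s <= t} -> 0 <= tau T0 -> 0 < T0 -> 0 < k ->
  nonincreasing_fun V -> (forall t, 0 <= V t) ->
  (forall t, T0 <= t -> (tail (EFin \o (V \o tau)) t <= (V t)%:E)%E) ->
  (forall t, t <= T0 -> V T0 + k * (T0 - Num.max t 0) <= V t) ->
  (forall s, T0 <= s -> exists2 u, s < u & tau u < s) ->
  exists x : R -> R,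
    [/\ solution tau T0 `[0, +oo[ x,
        forall t, `[0, +oo[%classic t -> 0 < x t
      & forall s t, `[0, +oo[%classic s -> `[0, +oo[%classic t ->
          s < t -> x t < x s].
Proof.
move=> tau_nd tauT0 T00 k0 Vni V0 Vsup Vstart flow.
have ktt (t : R) : 0 <= k * Num.max 0 (T0 - Num.max t 0).
  by apply: mulr_ge0; [exact: ltW|rewrite le_max lexx].
pose A (w : R -> R) t := fine (tail (EFin \o (w \o tau)) (Num.max t T0)) +
  k * Num.max 0 (T0 - Num.max t 0).
pose Q : set (R -> R) := [set w : R -> R | nonincreasing_fun w].
have wtau_ni w : Q w -> nonincreasing_fun (w \o tau).
  by move=> wni s t st; apply: wni; exact: tau_nd.
have mwtau w : Q w -> measurable_fun [set: R] (EFin \o (w \o tau)).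
  move=> wni; apply/measurable_EFinP; apply: nonincreasing_measurable => //.
  exact: wtau_ni.
pose L := [set w : R -> R | Q w /\ forall t, 0 <= w t <= V t].
have wV w t : L w -> T0 <= t -> (tail (EFin \o (w \o tau)) t <= (V t)%:E)%E.
  move=> [wni wV] t0; apply: le_trans (Vsup t t0); apply: le_tail.
  - by move=> u; rewrite lee_fin; have /andP[] := wV (tau u).
  - exact: mwtau.
  - exact: mwtau.
  - by move=> u _; rewrite lee_fin; have /andP[] := wV (tau u).
have wfin w t : L w -> T0 <= t -> tail (EFin \o (w \o tau)) t \is a fin_num.
  move=> Lw t0; rewrite ge0_fin_numE; last first.
    apply: tail_ge0 => u; rewrite lee_fin.
    by have /andP[] := Lw.2 (tau u).
  by apply: le_lt_trans (wV w t Lw t0) _; rewrite ltry.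
have [] := @monotone_fixed_point R R Q V A.
- move=> S SL [w0 Sw0] s t st; apply: ge_sup; first by exists (w0 t), w0.
  move=> _ [w Sw <-]; apply: le_trans ((SL _ Sw).1 _ _ st) _.
  apply: sup_upper_bound; last by exists w.
  split; first by exists (w s), w.
  by exists (V s) => _ [w' Sw' <-]; have /andP[] := (SL _ Sw').2 s.
- by split => // t; rewrite lexx V0.
- move=> w Lw; split.
    move=> s t st; rewrite /A; apply: lerD.
      have sT : T0 <= Num.max s T0 by rewrite le_max lexx orbT.
      have tT : T0 <= Num.max t T0 by rewrite le_max lexx orbT.
      apply: fine_le; [exact: wfin|exact: wfin|].
      apply: le_tail_point; last by rewrite ge_max !le_max st lexx orbT.
        by move=> u; rewrite lee_fin; have /andP[] := Lw.2 (tau u).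
      by apply: mwtau; exact: Lw.1.
    apply: ler_wpM2l; first exact: ltW.
    rewrite ge_max !le_max lexx/= lerD2l lerN2 ge_max !le_max.
    by rewrite st lexx !orbT.
  move=> t; apply/andP; split.
    rewrite addr_ge0// fine_ge0// tail_ge0// => u.
    by rewrite lee_fin; have /andP[] := Lw.2 (tau u).
  rewrite /A; have [tT|Tt] := leP t T0.
    apply: le_trans (Vstart t tT).
    apply: lerD; first by rewrite -lee_fin fineK ?wfin// wV.
    apply: ler_wpM2l; first exact: ltW.
    by rewrite max_r// subr_ge0 ge_max tT ltW.
  rewrite [X in _ + k * X]max_l ?mulr0 ?addr0; last first.
    by rewrite subr_le0 le_max ltW.
  have Tt' := ltW Tt.
  by rewrite -lee_fin fineK ?wfin// wV.
- move=> w w' Lw Lw' ww' t; rewrite /A lerD2r.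
  have tT : T0 <= Num.max t T0 by rewrite le_max lexx orbT.
  apply: fine_le; [exact: wfin|exact: wfin|].
  apply: le_tail.
  + by move=> u; rewrite lee_fin; have /andP[] := Lw.2 (tau u).
  + by apply: mwtau; exact: Lw.1.
  + by apply: mwtau; exact: Lw'.1.
  + by move=> u _; rewrite lee_fin; exact: ww'.
move=> x Lx Ax; exists x.
have [xni x0V] := Lx.
have x0 t : 0 <= x t by have /andP[] := x0V t.
pose h := x \o tau.
have xE t : T0 <= t -> x t = fine (tail (EFin \o h) t).
  move=> Tt; rewrite -Ax /A max_l// [X in _ + k * X]max_l ?mulr0 ?addr0//.
  by rewrite subr_le0 le_max Tt.
have xE' t : 0 <= t -> t <= T0 -> x t = x T0 + k * (T0 - t).
  move=> t0 tT; rewrite -Ax /A -/h xE// max_r// [Num.max t 0]max_l//.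
  by rewrite max_r ?subr_ge0.
have hni : nonincreasing_fun h by exact: wtau_ni.
have h0 u : 0 <= h u by exact: x0.
have finT0 : (tail (EFin \o h) T0 < +oo)%E.
  by have := wfin x T0 Lx (lexx _); rewrite fin_numE -ltey => /andP[].
have [y yP] := tail_slopes hni h0 finT0.
have hy s t : T0 <= s -> s <= t -> h t * (t - s) <= y t - y s <= h s * (t - s).
  by move=> Ts st; have [] := yP s t Ts st.
have hx s t : T0 <= s -> s <= t -> y s * (t - s) <= x t - x s <= y t * (t - s).
  by move=> Ts st; have [_] := yP s t Ts st; rewrite !xE// (le_trans Ts).
(* The slope of x is at least y T0 after T0 and equal to - k before. *)
pose K := `|y T0| + k.
have K0 : 0 < K by rewrite ltr_wpDl.
have lipR s t : T0 <= s -> s <= t -> x s - x t <= `|y T0| * (t - s).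
  move=> Ts st; have /andP[h1 _] := hx s t Ts st.
  have /andP[h2 _] := hy T0 s (lexx _) Ts.
  have h3 : 0 <= h s * (s - T0) by rewrite mulr_ge0// subr_ge0.
  have h4 : - y T0 <= `|y T0| by rewrite -normrN ler_norm.
  have h5 : - y s <= `|y T0| by lra.
  have h6 : - y s * (t - s) <= `|y T0| * (t - s).
    by rewrite ler_wpM2r// subr_ge0.
  by rewrite mulNr in h6; lra.
have lip s t : 0 <= s -> s <= t -> x s - x t <= K * (t - s).
  move=> s0 st; have n0 := normr_ge0 (y T0).
  have [Ts|sT] := leP T0 s.
    apply: le_trans (lipR s t Ts st) _.
    by rewrite ler_wpM2r ?subr_ge0// lerDl ltW.
  have [tT|Tt] := leP t T0.
    rewrite (xE' s)// ?(ltW sT)// (xE' t)// ?(le_trans s0)//.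
    have : 0 <= `|y T0| * (t - s) by rewrite mulr_ge0// subr_ge0.
    rewrite /K; nra.
  have := lipR T0 t (lexx _) (ltW Tt); rewrite (xE' s)// ?(ltW sT)//.
  have : 0 <= `|y T0| * (T0 - s) by rewrite mulr_ge0// subr_ge0 ltW.
  have : 0 <= k * (t - T0) by rewrite mulr_ge0 ?subr_ge0// ltW.
  rewrite /K; nra.
have taupos u : T0 <= u -> 0 <= tau u.
  by move=> Tu; apply: le_trans tauT0 _; exact: tau_nd.
have hpos s : T0 <= s -> (forall t, 0 <= t -> t < s -> 0 < x t) -> 0 < x s.
  move=> Ts xs; have [u su us] := flow s Ts.
  rewrite xE//; apply: fine_gt0; apply/andP; split; last first.
    by have := wfin x s Lx Ts; rewrite fin_numE -ltey => /andP[].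
  apply: (@tail_gt0 _ _ _ u (x (tau u))) => //.
  - exact: mwtau.
  - by apply: xs => //; rewrite taupos// (le_trans Ts)// ltW.
  - by move=> v _ vu; apply: xni; exact: tau_nd.
have xpos t : 0 <= t -> 0 < x t.
  move=> t0; rewrite ltNge; apply/negP => xt0.
  pose Z := [set t | 0 <= t /\ x t <= 0].
  have hZ : has_inf Z by split; [exists t|exists 0 => z []].
  pose s := inf Z.
  have xT t' : 0 <= t' -> t' < T0 -> 0 < x t'.
    move=> t'0 t'T; rewrite xE' ?(ltW t'T)//.
    by rewrite ltr_wpDl// mulr_gt0 ?subr_gt0//.
  have Ts : T0 <= s.
    apply: lb_le_inf; first by exists t.
    move=> z [z0 xz]; rewrite leNgt; apply/negP => zT.
    by have := xT z z0 zT; rewrite ltNge xz.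
  have s0 : 0 <= s by rewrite (le_trans _ Ts)// ltW.
  have xs : 0 < x s.
    apply: hpos => // t' t'0 t's; rewrite ltNge; apply/negP => xt'.
    have : s <= t' by apply: ge_inf; [exact: hZ.2|split].
    by rewrite leNgt t's.
  have e0 : 0 < x s / K by rewrite divr_gt0.
  have [z [z0 xz] zs] := inf_adherent e0 hZ.
  have sz : s <= z by apply: ge_inf; [exact: hZ.2|split].
  have := lip s z s0 sz.
  have : K * (z - s) < x s.
    by rewrite mulrC -ltr_pdivlMr// ltrBlDl.
  lra.
split; last 2 first.
- by move=> t /=; rewrite in_itv/= andbT; exact: xpos.
- move=> s t /=; rewrite !in_itv/= !andbT => s0 t0 st.
  have dec := @decreasing_of_slopes x y h T0 _ _ hy hx.
  have [Ts|sT] := leP T0 s.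
    apply: dec => //; first by move=> s' t' _; exact: xni.
    by move=> u Tu; apply: xpos; exact: taupos.
  apply: (@le_lt_trans _ _ (x (Num.min t T0))).
    by apply: xni; rewrite ge_min lexx.
  have m0 : 0 <= Num.min t T0 by rewrite le_min t0 ltW.
  rewrite (xE' s)// ?(ltW sT)// (xE' (Num.min t T0))// ?ge_min ?lexx ?orbT//.
  by rewrite ltrD2l ltr_pM2l// ltrD2l ltrN2 lt_min st.
apply: (@solution_of_slopes _ _ _ y) => //.
- exact: interval_is_interval.
- by move=> t /=; rewrite !in_itv/= !andbT; apply: le_trans; exact: ltW.
- move=> _ [t /= + <-]; rewrite !in_itv/= !andbT; exact: taupos.
- apply: (@lipschitz_within_continuous _ _ _ K) => s t /=.
  rewrite !in_itv/= !andbT => s0 _ st.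
  by rewrite ler0_norm ?subr_le0 ?xni// opprB; exact: lip.
Qed.

End supersolutions.

(** * Limits of the delay, and constant delay *)

Section delays.
Variable R : realType.
Implicit Types (d : R -> R) (a b : R).

Lemma limf_delay d a b (T0 : R) :
  (forall t, T0 <= t -> a <= d t <= b) ->
  (forall T e, 0 < e -> exists2 t, T <= t & d t <= a + e) ->
  (forall T e, 0 < e -> exists2 t, T <= t & b - e <= d t) ->
  limf_einf (fun t => (d t)%:E) +oo = a%:E /\
  limf_esup (fun t => (d t)%:E) +oo = b%:E.
Proof.
move=> dab da db.
have T0oo : +oo [set t | T0 <= t] by exact: nbhs_pinfty_ge (num_real _).
split.
- rewrite limf_einfE; apply/eqP; rewrite eq_le; apply/andP; split.
    apply: ge_ereal_sup => _ [V [M [_ MV]] <-].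
    apply/lee_addgt0Pr => e e0.
    have [t Mt dt] := da (M + 1) e e0.
    apply: (@le_trans _ _ (d t)%:E); last by rewrite -EFinD lee_fin.
    apply: ereal_inf_lbound; exists t => //.
    by apply: MV; apply: lt_le_trans Mt; rewrite ltrDl.
  apply: le_ereal_sup_tmp.
  exists (ereal_inf ((fun t => (d t)%:E) @` [set t | T0 <= t])).
    by exists [set t | T0 <= t].
  apply: le_ereal_inf_tmp => _ [t /= T0t <-].
  by rewrite lee_fin; have /andP[] := dab t T0t.
- rewrite limf_esupE; apply/eqP; rewrite eq_le; apply/andP; split.
    apply: ge_ereal_inf.
    exists (ereal_sup ((fun t => (d t)%:E) @` [set t | T0 <= t])).
      by exists [set t | T0 <= t].
    apply: ge_ereal_sup => _ [t /= T0t <-].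
    by rewrite lee_fin; have /andP[] := dab t T0t.
  apply: le_ereal_inf_tmp => _ [V [M [_ MV]] <-].
  apply/lee_subgt0Pr => e e0.
  have [t Mt dt] := db (M + 1) e e0.
  apply: (@le_trans _ _ (d t)%:E); first by rewrite -EFinB lee_fin.
  apply: ereal_sup_ubound; exists t => //.
  by apply: MV; apply: lt_le_trans Mt; rewrite ltrDl.
Qed.

(** The convex function exp(- m t) lies above its tangents at s and at t. *)
Lemma exp_slopes (m s t : R) : s <= t ->
  m * expR (- m * t) * (t - s) <= expR (- m * s) - expR (- m * t)
    <= m * expR (- m * s) * (t - s).
Proof.
move=> st.
have es : expR (- m * s) = expR (- m * t) * expR (m * (t - s)).
  by rewrite -expRD; congr expR; ring.
have et : expR (- m * t) = expR (- m * s) * expR (- (m * (t - s))).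
  by rewrite -expRD; congr expR; ring.
have h1 := expR_ge1Dx (m * (t - s)).
have h2 := expR_ge1Dx (- (m * (t - s))).
have p1 := expR_ge0 (- m * t); have p2 := expR_ge0 (- m * s).
by apply/andP; split; [rewrite {1}es|rewrite {1}et]; nra.
Qed.

(** At m = e the sign of m - exp(m a / 2) is right exactly because a <= 2 / e.
    *)
Lemma exp_rate a : 0 <= a <= 2 / expR 1 ->
  exists2 m : R, 0 < m & m = expR (m * a / 2).
Proof.
move=> /andP[a0 ae].
have e0 : 0 < expR 1 :> R by exact: expR_gt0.
pose f (m : R) := m - expR (m * a / 2).
have cf : continuous f.
  move=> m; apply: cvgB; first exact: cvg_id.
  apply: (@continuous_comp _ _ _ (fun m : R => m * a / 2)); last first.
    exact: continuous_expR.
  by apply: cvgM; [apply: cvgM; [exact: cvg_id|exact: cvg_cst]|exact: cvg_cst].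
have f0 : f 0 <= 0 by rewrite /f !mul0r expR0 sub0r oppr_le0.
have fe : 0 <= f (expR 1).
  rewrite subr_ge0 ler_expR.
  have : expR 1 * a <= 2 by rewrite mulrC -ler_pdivlMr.
  lra.
have [] := @IVT R f 0 (expR 1) 0 (ltW e0) _ _.
- exact: continuous_subspaceT.
- by rewrite ge_min f0 le_max fe orbT.
move=> m _ /eqP; rewrite subr_eq0 => /eqP me; exists m => //.
by rewrite me expR_gt0.
Qed.


Definition delay_range_realized a b : Prop :=
  exists tau : R -> R,
    [/\ {homo tau : s t / s <= t},
        forall t, tau t <= t,
        tau t @[t --> +oo] --> +oo,
        exists (t0 : R) (J : set R) (x : R -> R),
          [/\ solution tau t0 J x,
              forall t, J t -> 0 < x t
            & forall s t, J s -> J t -> s < t -> x t < x s]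
      & limf_einf (fun t : R => (t - tau t)%:E) +oo = a%:E /\
        limf_esup (fun t : R => (t - tau t)%:E) +oo = b%:E].

Lemma bounded_delay_cvg (tau : R -> R) b : (forall t, t - tau t <= b) ->
  tau t @[t --> +oo] --> +oo.
Proof.
move=> db; apply/cvgryPge => M.
near=> t; have := db t.
have : M + b <= t by near: t; exact: nbhs_pinfty_ge (num_real _).
lra.
Unshelve. all: by end_near. Qed.

(** The rate m gives x (t - a) = exp(m a) x t = m ^ 2 x t. *)
Lemma constant_delay_realized a : 0 <= a <= 2 / expR 1 ->
  delay_range_realized a a.
Proof.
move=> a0e; have [a0 _] := andP a0e.
have [m m0 mE] := exp_rate a0e.
pose x t : R := expR (- m * t).
exists (fun t => t - a); split.
- by move=> s t st; rewrite lerD2r.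
- by move=> t; rewrite gerBl.
- by apply: (@bounded_delay_cvg _ a) => t; rewrite opprB addrC subrK.
- exists 0, setT, x; split.
  + have xE t : x (t - a) = m * (m * x t).
      rewrite /x {2 3}mE -!expRD.
      by congr expR; field.
    have xni : nonincreasing_fun x.
      by move=> s t st; rewrite ler_expR !mulNr lerN2 ler_wpM2l// ltW.
    apply: (@solution_of_slopes _ _ _ (fun t => - (m * x t))) => //.
    * apply: continuous_subspaceT => t; apply: continuous_comp.
        exact: mulrl_continuous.
      exact: continuous_expR.
    * by move=> s t st /=; apply: xni; rewrite lerD2r.
    * by move=> t _; exact: expR_ge0.
    * move=> s t _ st; rewrite !xE; have /andP[] := exp_slopes m st.
      rewrite -/(x t) -/(x s); nra.
    * move=> s t _ st; have /andP[] := exp_slopes m st.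
      rewrite -/(x t) -/(x s); nra.
  + by move=> t _; exact: expR_gt0.
  + by move=> s t _ _ st; rewrite ltr_expR !mulNr ltrN2 ltr_pM2l.
- have dE t : t - (t - a) = a by rewrite opprB addrC subrK.
  by apply: (@limf_delay _ a a 0) => [t _|T e e0|T e e0]; [|exists T|exists T];
    rewrite ?dE//; lra.
Qed.

End delays.

(** * The case a = 0 *)

Section partition.
Variable R : realType.
Implicit Types (t : nat -> R).

Lemma nodes_le t m n : (forall n, t n <= t n.+1) -> (m <= n)%N -> t m <= t n.
Proof.
move=> tS mn; elim: n mn => [|n ih]; first by rewrite leqn0 => /eqP ->.
rewrite leq_eqVlt => /predU1P[->//|mn].
by apply: le_trans (ih mn) _.
Qed.

Lemma node_interval t s : t 0%N <= s -> (exists n, s < t n) ->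
  exists n, t n <= s < t n.+1.
Proof.
move=> s0 ex; have [n sn nmin] := ex_minnP ex.
case: n sn nmin => [|n] sn nmin; first by move: sn; rewrite ltNge s0.
exists n; rewrite sn andbT leNgt; apply/negP => /nmin.
by rewrite ltnn.
Qed.

Lemma node_interval_unique t s m n : (forall n, t n <= t n.+1) ->
  t m <= s < t m.+1 -> t n <= s < t n.+1 -> m = n.
Proof.
move=> tS /andP[ms sm] /andP[ns sn].
have [mn|nm|//] := ltngtP m n.
  by have := nodes_le tS mn; rewrite leNgt (le_lt_trans ns sm).
by have := nodes_le tS nm; rewrite leNgt (le_lt_trans ms sn).
Qed.

(** A relation between two times that is transitive along increasing times need
    only be checked between consecutive nodes. *)
Lemma interval_gluing t (P : R -> R -> Prop) :
  (forall M, exists n, M < t n) ->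
  (forall n, t n <= t n.+1) ->
  (forall n u v, t n <= u -> u <= v -> v <= t n.+1 -> P u v) ->
  (forall u w v, t 0%N <= u -> u <= w -> w <= v -> P u w -> P w v -> P u v) ->
  forall u v, t 0%N <= u -> u <= v -> P u v.
Proof.
move=> tinf tS Ploc Ptr u v u0 uv.
have [n /ltW vn] := tinf v.
elim: n u v u0 uv vn => [|n ih] u v u0 uv vn.
  by apply: (Ploc 0%N) => //; apply: le_trans vn _.
have [vtn|/ltW tnv] := leP v (t n); first exact: ih.
have [tnu|/ltW utn] := leP (t n) u; first exact: Ploc tnu uv vn.
by apply: (Ptr u (t n)) => //; [exact: ih|exact: Ploc].
Qed.

End partition.

Section no_delay.
Variable R : realType.

(** X n and - p n are to be the value and the slope, at the n-th node, of a
    solution whose second derivative is X n on the next interval, of length b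
    n. The ratios r n = p n / X n must satisfy the backward recursion r n = b n
    + r n.+1 (1 - b n ^ 2 / 2) / (1 + r n.+1 b n), whose right-hand side is
    nonnegative because b n ^ 2 < 2, increases with r n.+1, and is at most b n
    + 1 / b n. A fixed point in the lattice of bounded sequences solves it for
    all n at once; running the recursion forward instead would be unstable. *)
Lemma quadratic_data (b : nat -> R) (d : R) : 0 < d ->
  (forall n, d <= b n) -> (forall n, b n ^+ 2 < 2) ->
  exists X p : nat -> R, forall n,
    [/\ 0 < X n, 0 <= p n, p n.+1 = p n - b n * X n
      & X n.+1 = X n - p n * b n + X n * b n ^+ 2 / 2].
Proof.
move=> d0 db b2.
have b0 n : 0 < b n by exact: lt_le_trans d0 (db n).
have bs2 n : b n <= 2 by have := b2 n; have := b0 n; nra.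
pose A (r : nat -> R) n := b n + r n.+1 * (1 - b n ^+ 2 / 2) / (1 + r n.+1 * b n).
pose K := 2 + d^-1.
have c0 n : 0 < 1 - b n ^+ 2 / 2 by have := b2 n; lra.
have dV : 0 < d^-1 by rewrite invr_gt0.
have K0 : 0 <= K by rewrite /K; lra.
have den n (q : R) : 0 <= q -> 0 < 1 + q * b n.
  by move=> q0; rewrite ltr_wpDr// mulr_ge0// ltW.
have [] := @monotone_fixed_point R nat setT (fun=> K) A.
- by [].
- by split=> // n; rewrite lexx K0.
- move=> r [_ rK]; split=> // n; rewrite /A.
  have /andP[q0 qK] := rK n.+1; set q := r n.+1 in q0 qK *.
  have f0 : 0 <= q * (1 - b n ^+ 2 / 2) / (1 + q * b n).
    by rewrite divr_ge0 ?(ltW (den _ _ q0))// mulr_ge0// ltW.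
  apply/andP; split; first by rewrite addr_ge0// ltW.
  apply: lerD; first exact: bs2.
  rewrite ler_pdivrMr ?den//.
  have h1 : q * (1 - b n ^+ 2 / 2) <= q.
    by rewrite ler_piMr// gerBl divr_ge0 ?sqr_ge0.
  apply: le_trans h1 _; rewrite mulrDr mulr1.
  have h2 : q <= d^-1 * (q * b n).
    by rewrite mulrCA ler_peMr// ler_pdivlMl// mulr1.
  by lra.
- move=> r r' [_ rK] [_ rK'] rr' n; rewrite /A lerD2l.
  have /andP[q0 _] := rK n.+1; have /andP[q0' _] := rK' n.+1.
  have := rr' n.+1; set q := r n.+1 in q0 *; set q' := r' n.+1 in q0' * => qq'.
  rewrite ler_pdivrMr ?den// [leRHS]mulrAC ler_pdivlMr ?den//.
  rewrite -subr_ge0 (_ : _ - _ = (q' - q) * (1 - b n ^+ 2 / 2)); last by ring.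
  by apply: mulr_ge0; [rewrite subr_ge0|exact: ltW].
move=> r [_ rK] rE.
(* The ratio X n.+1 / X n. *)
pose rho n := (1 - b n ^+ 2 / 2) / (1 + r n.+1 * b n).
have r0 n : 0 <= r n by have /andP[] := rK n.
have rho0 n : 0 < rho n by rewrite divr_gt0 ?den.
pose X n : R := \prod_(i < n) rho i.
have XS n : X n.+1 = X n * rho n by rewrite /X big_ord_recr.
have X0 n : 0 < X n by apply: prodr_gt0 => i _.
have rrho n : r n = b n + r n.+1 * rho n.
  by rewrite -[LHS]rE /A /rho mulrA.
exists X, (fun n => r n * X n) => n; split=> //.
- by rewrite mulr_ge0// ltW.
- by rewrite XS [in RHS]rrho; ring.
- rewrite XS [in RHS]rrho.
  have : rho n * (1 + r n.+1 * b n) = 1 - b n ^+ 2 / 2.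
    by rewrite /rho divfK// gt_eqF// den.
  move=> e; have -> : X n - (b n + r n.+1 * rho n) * X n * b n + X n * b n ^+ 2 / 2
    = X n * (1 - b n ^+ 2 / 2 - (rho n * (1 + r n.+1 * b n) - rho n)) by field.
  by rewrite e; ring.
Qed.


(** The delay is a sawtooth: it rises from 0 to bn n along the n-th interval.
    Since bn n < b <= sqrt 2, the sawtooth may come arbitrarily close to the
    critical height sqrt 2. *)
Lemma vanishing_delay_realized (b : R) : 0 < b <= Num.sqrt 2 ->
  delay_range_realized 0 b.
Proof.
move=> /andP[b0 b2].
have bb2 : b ^+ 2 <= 2.
  rewrite -[leRHS](@sqr_sqrtr R 2)// ler_pXn2r// ?nnegrE ?sqrtr_ge0//.
  exact: ltW.
pose bn n : R := b - b / n.+2%:R.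
have bn_lt n : bn n < b by rewrite /bn gtrBl divr_gt0.
have bn_ge n : b / 2 <= bn n.
  have : b / n.+2%:R <= b / 2 by rewrite ler_wpM2l ?(ltW b0)// lef_pV2 ?posrE// ler_nat.
  by rewrite /bn; set c := b / n.+2%:R; lra.
have d0 : 0 < b / 2 by lra.
have bn0 n : 0 < bn n by exact: lt_le_trans (bn_ge n).
have bn2 n : bn n ^+ 2 < 2.
  apply: lt_le_trans bb2.
  by rewrite ltr_pXn2r ?nnegrE ?ltW// (lt_trans (bn0 n)).
have [X [p Xp]] := quadratic_data d0 bn_ge bn2.
pose t n : R := \sum_(i < n) bn i.
have tS n : t n.+1 = t n + bn n by rewrite /t big_ord_recr.
have t0 : t 0%N = 0 by rewrite /t big_ord0.
have tle n : t n <= t n.+1 by rewrite tS lerDl ltW.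
have tge n : n%:R * (b / 2) <= t n.
  elim: n => [|n ih]; first by rewrite mul0r t0.
  by rewrite tS -natr1 mulrDl mul1r lerD.
have tinf M : exists n, M < t n.
  exists (Num.truncn (M / (b / 2))).+1; apply: lt_le_trans (tge _).
  by rewrite -ltr_pdivrMr// truncnS_gt.
have nodeP s : 0 <= s -> exists n, t n <= s < t n.+1.
  by move=> s0; apply: node_interval; [rewrite t0|exact: tinf].
pose idx s : nat := xget 0%N [set n | t n <= s < t n.+1].
have idxP s : 0 <= s -> t (idx s) <= s < t (idx s).+1.
  by move=> s0; exact: (xgetPex 0%N (nodeP s s0)).
have t_ge0 n : 0 <= t n by rewrite -t0; exact: nodes_le.
have idxE s n : t n <= s < t n.+1 -> idx s = n.
  move=> ns; apply: (node_interval_unique tle) (ns); apply: idxP.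
  by case/andP: ns => ns _; exact: le_trans ns.
pose tau s : R := if s < 0 then s else t (idx s).
pose x s : R := let u := Num.max s 0 in let n := idx u in
  X n - p n * (u - t n) + X n * (u - t n) ^+ 2 / 2.
pose y s : R := let n := idx s in - p n + X n * (s - t n).
have X0 n : 0 < X n by have [] := Xp n.
have p0 n : 0 <= p n by have [] := Xp n.
have tt n : t n <= t n < t n.+1 by rewrite lexx tS ltrDl bn0.
(* At the node t n.+1 the formulas of the n-th and of the next piece agree, so
   the formula of the n-th piece holds on the closed interval. *)
have pieceE n s : t n <= s -> s <= t n.+1 ->
    x s = X n - p n * (s - t n) + X n * (s - t n) ^+ 2 / 2 /\
    y s = - p n + X n * (s - t n).
  move=> ns; have s0 : 0 <= s by exact: le_trans ns.
  rewrite /x /y max_l// le_eqVlt => /predU1P[->|sn]; last first.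
    by rewrite (idxE s n) // ns sn.
  rewrite (idxE _ n.+1) // tS; have [_ _ -> ->] := Xp n.
  by split; ring.
have XE n : x (t n) = X n.
  have [-> _] := pieceE n (t n) (lexx _) (tle n).
  by rewrite subrr expr0n/= !mulr0 mul0r addr0 subr0.
have tauE n s : t n <= s < t n.+1 -> tau s = t n.
  move=> ns; rewrite /tau (idxE s n)// ltNge.
  by have /andP[ns' _] := ns; rewrite (le_trans (t_ge0 n)).
have XS n : X n.+1 <= X n.
  have [_ _ pE ->] := Xp n; have := p0 n.+1; rewrite pE.
  have := bn0 n; have := X0 n; have := mulr_gt0 (bn0 n) (X0 n); nra.
have Xle m n : (m <= n)%N -> X n <= X m.
  move=> mn; rewrite -lerN2.
  by apply: (@nodes_le _ (fun n => - X n)) => // k; rewrite lerN2.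
have idx_le r s : 0 <= r -> r <= s -> (idx r <= idx s)%N.
  move=> r0 rs; rewrite leqNgt; apply/negP => sr.
  have /andP[ir _] := idxP _ r0; have /andP[_ si] := idxP _ (le_trans r0 rs).
  have := nodes_le tle sr; lra.
have tau_le s : tau s <= s.
  rewrite /tau; case: ltP => // s0; by have /andP[] := idxP _ s0.
have tau_nd : {homo tau : s r / s <= r}.
  move=> r s rs; rewrite {2}/tau; case: ltP => s0.
    by apply: le_trans (tau_le r) rs.
  rewrite /tau; case: ltP => r0; first by apply: le_trans (ltW r0) _.
  by apply: nodes_le => //; exact: idx_le.
have hE s : 0 <= s -> x (tau s) = X (idx s).
  by move=> s0; rewrite (tauE (idx s)) ?XE ?idxP.
have h0 s : 0 <= s -> 0 < x (tau s) by move=> s0; rewrite hE.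
(* With h = x o tau piecewise constant, y is piecewise affine and x piecewise
   quadratic; the slope estimates on one piece are identities up to the sign of
   X n * (s - r) ^+ 2 / 2. *)
have hni r s : 0 <= r -> r <= s -> x (tau s) <= x (tau r).
  move=> r0 rs; rewrite !hE ?(le_trans r0)//; apply: Xle; exact: idx_le.
pose P r s := (x (tau s) * (s - r) <= y s - y r <= x (tau r) * (s - r)) /\
  (y r * (s - r) <= x s - x r <= y s * (s - r)).
have slopes r s : 0 <= r -> r <= s -> P r s.
  rewrite -{1}t0; move: r s; apply: (@interval_gluing _ t) => //.
  - move=> n r s nr rs sn.
    have [ns rn] := (le_trans nr rs, le_trans rs sn).
    have [xr yr] := pieceE n r nr rn; have [xs ys] := pieceE n s ns sn.
    have r0 := le_trans (t_ge0 n) nr; have s0 := le_trans r0 rs.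
    have hs : x (tau s) <= X n.
      by have := hni (t n) s (t_ge0 n) ns; rewrite (tauE n (t n))// XE.
    have Xsr : 0 <= X n * (s - r) by rewrite mulr_ge0 ?subr_ge0// ltW.
    have Xsr2 : 0 <= X n * (s - r) ^+ 2.
      by rewrite mulr_ge0 ?sqr_ge0// ltW.
    split.
      have -> : y s - y r = X n * (s - r) by rewrite ys yr; ring.
      rewrite ler_wpM2r ?subr_ge0//=.
      move: rs; rewrite le_eqVlt => /predU1P[->|rs]; first by rewrite subrr !mulr0.
      by rewrite (tauE n r) ?XE// nr (lt_le_trans rs).
    have e1 : x s - x r = y r * (s - r) + X n * (s - r) ^+ 2 / 2.
      by rewrite xs xr yr; field.
    have e2 : x s - x r = y s * (s - r) - X n * (s - r) ^+ 2 / 2.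
      by rewrite xs xr ys; field.
    by apply/andP; split; [rewrite e1|rewrite e2]; lra.
  - rewrite t0 => r w s r0 rw ws [/andP[y1 y2] /andP[x1 x2]] [/andP[y3 y4] /andP[x3 x4]].
    have w0 := le_trans r0 rw; have s0 := le_trans w0 ws.
    have dwr : 0 <= w - r by rewrite subr_ge0.
    have dsw : 0 <= s - w by rewrite subr_ge0.
    have yrw : y r <= y w.
      have : 0 <= x (tau w) * (w - r) by rewrite mulr_ge0// ltW// h0.
      lra.
    have yws : y w <= y s.
      have : 0 <= x (tau s) * (s - w) by rewrite mulr_ge0// ltW// h0.
      lra.
    have m1 := ler_wpM2r dwr (hni w s w0 ws).
    have m2 := ler_wpM2r dsw (hni r w r0 rw).
    have m3 := ler_wpM2r dsw yrw.
    have m4 := ler_wpM2r dwr yws.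
    rewrite /P; have -> : s - r = (s - w) + (w - r) by ring.
    by split; rewrite !mulrDr; apply/andP; split; lra.
have y_le0 s : 0 <= s -> y s <= 0.
  move=> s0; have /andP[ns /ltW sn] := idxP _ s0.
  have [_ ->] := pieceE _ _ ns sn.
  have [_ _ pE _] := Xp (idx s); have := p0 (idx s).+1; rewrite pE.
  have : X (idx s) * (s - t (idx s)) <= X (idx s) * bn (idx s).
    by rewrite ler_wpM2l ?(ltW (X0 _))// lerBlDl -tS.
  lra.
have xni r s : 0 <= r -> r <= s -> x s <= x r.
  move=> r0 rs; have [_ /andP[_ h1]] := slopes r s r0 rs.
  rewrite -subr_le0; apply: le_trans h1 _.
  by rewrite mulr_le0_ge0 ?subr_ge0// y_le0// (le_trans r0).
have xpos s : 0 <= s -> 0 < x s.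
  move=> s0; have /andP[_ /ltW sn] := idxP _ s0.
  by apply: lt_le_trans (xni _ _ s0 sn); rewrite XE.
have xneg s : s <= 0 -> x s = x 0.
  by move=> s0; rewrite /x (max_r s0) maxxx.
have delay s : 0 <= s -> 0 <= s - tau s <= b.
  move=> s0; rewrite subr_ge0 tau_le/= (tauE (idx s)) ?idxP//.
  have /andP[_] := idxP _ s0; rewrite tS => h1.
  by rewrite lerBlDl ltW// (lt_le_trans h1)// lerD2l ltW.
exists tau; split => //.
- apply: (@bounded_delay_cvg _ _ b) => s; have [s0|/delay/andP[]//] := ltP s 0.
  by rewrite /tau s0 subrr ltW.
- exists 0, `[0, +oo[%classic, x; split.
  + have x0ni : nonincreasing_fun x.
      move=> r s rs; have [r0|/ltW r0] := leP 0 r; first exact: xni.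
      rewrite (xneg r)//; have [s0|/ltW s0] := leP 0 s; first exact: xni.
      by rewrite xneg.
    apply: (@solution_of_slopes _ _ _ y) => //.
    * exact: interval_is_interval.
    * move=> _ [s /= + <-]; rewrite !in_itv/= !andbT => s0.
      by rewrite (tauE (idx s)) ?idxP.
    * apply: (@lipschitz_within_continuous _ _ _ (- y 0)) => r s /=.
      rewrite !in_itv/= !andbT => r0 s0 rs.
      rewrite ler0_norm ?subr_le0 ?xni// opprB.
      have [_ /andP[h1 _]] := slopes r s r0 rs.
      have [/andP[h2 _] _] := slopes 0 r (lexx _) r0.
      have : 0 <= x (tau r) * (r - 0) by rewrite mulr_ge0 ?subr_ge0// ltW// h0.
      move=> h3; have h4 : - y r <= - y 0 by lra.
      have := @ler_wpM2r _ (s - r) _ _ _ h4; rewrite subr_ge0 => /(_ rs).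
      lra.
    * by move=> r s rs /=; apply: x0ni; exact: tau_nd.
    * by move=> s s0; apply: ltW; exact: h0.
    * by move=> r s r0 rs; have [] := slopes r s r0 rs.
    * by move=> r s r0 rs; have [] := slopes r s r0 rs.
  + by move=> s /=; rewrite in_itv/= andbT; exact: xpos.
  + move=> r s /=; rewrite !in_itv/= !andbT => r0 _.
    apply: (@decreasing_of_slopes _ x y (x \o tau) 0) => // r' s' r'0 rs'.
      by have [] := slopes r' s' r'0 rs'.
    by have [] := slopes r' s' r'0 rs'.
- apply: (@limf_delay _ _ 0 b 0) => // T e e0.
    have [n Tn] := tinf T; exists (t n); first exact: ltW.
    by rewrite (tauE n)// subrr add0r ltW.
  pose n := (Num.truncn (`|T| / (b / 2) + b / (e / 2))).+1.
  have nT : `|T| / (b / 2) + b / (e / 2) < n%:R by exact: truncnS_gt.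
  have q1 : 0 <= `|T| / (b / 2) by rewrite divr_ge0// ltW.
  have q2 : 0 <= b / (e / 2) by rewrite divr_ge0// ltW// divr_gt0.
  have Tn : T <= t n.
    apply: le_trans (ler_norm T) _; apply: le_trans (tge n).
    rewrite -ler_pdivrMr//; lra.
  have bne : b - e / 2 <= bn n.
    rewrite lerD2l lerN2 ler_pdivrMr// mulrC -ler_pdivrMr; last by lra.
    have : n%:R <= n.+2%:R :> R by rewrite ler_nat -addn2 leq_addr.
    lra.
  pose u := Num.max 0 (bn n - e / 2).
  have u0 : 0 <= u by rewrite le_max lexx.
  have ub : u < bn n by rewrite gt_max bn0/= gtrBl; lra.
  have ue : b - e <= u by rewrite le_max; apply/orP; right; lra.
  exists (t n + u); first by rewrite (le_trans Tn)// lerDl.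
  by rewrite (tauE n) ?lerDl ?u0 ?tS ?ltrD2l// addrAC subrr add0r.
Qed.

End no_delay.

(** * Profiles with one stretch *)

Section stretch_profiles.
Variable R : realType.
Implicit Types (t u s k p q a b : R) (F : R -> R).
Local Notation mu := (@lebesgue_measure R).

(** The function F o sigma for the delay sigma u = u - a outside [a, p] and
    sigma = 0 on [a, p], with the value F 0 on [a, p] replaced by the parameter
    c. *)
Definition stretch_source F (a p c : R) : R -> R :=
  fun u => c * \1_`[a, p] u + \1_(~` `[a, p]) u * F (u - a).

Lemma stretch_source_in F (a p c u : R) : a <= u <= p ->
  stretch_source F a p c u = c.
Proof.
move=> aup; have mem : u \in `[a, p]%classic by rewrite mem_setE in_itv.
by rewrite /stretch_source !indicE in_setC mem mulr1 mul0r addr0.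
Qed.

Lemma stretch_source_out F (a p c u : R) : ~~ (a <= u <= p) ->
  stretch_source F a p c u = F (u - a).
Proof.
move=> aup; have /negbTE mem : u \notin `[a, p]%classic.
  by rewrite mem_setE in_itv.
by rewrite /stretch_source !indicE in_setC mem mulr0 mul1r add0r.
Qed.

Lemma measurable_stretch_source F (a p c : R) : nonincreasing_fun F ->
  measurable_fun [set: R] (EFin \o stretch_source F a p c).
Proof.
move=> Fni; apply/measurable_EFinP; apply: measurable_funD.
  by apply: measurable_funM => //; exact: measurable_indic.
apply: measurable_funM; first by apply: measurable_indic; exact: measurableC.
apply: nonincreasing_measurable => // s t st.
by apply: Fni; rewrite lerD2r.
Qed.

Lemma stretch_source_ge0 F (a p c u : R) : (forall t, 0 <= F t) -> 0 <= c ->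
  0 <= stretch_source F a p c u.
Proof. by move=> F0 c0; rewrite addr_ge0// mulr_ge0. Qed.

(** A solution on the whole line for one stretch [a, be], normalized at the
    start of the stretch. The decay condition says that exp(l s) F s tends to 0
    as s tends to either infinity, so that far-away translates of F, scaled by
    this weight, hardly interact. *)
Record stretch_profile (a be l : R) (F : R -> R) : Prop := StretchProfile {
  profile_nonincreasing : nonincreasing_fun F;
  profile_ge0 : forall t, 0 <= F t;
  profile_normalized : F 0 = 1;
  profile_tail : forall t,
    tail (EFin \o stretch_source F a be 1) t = (F t)%:E;
  profile_decay : forall d, 0 < d -> exists r : R, forall s, r <= s ->
    expR (l * s) * F s <= d /\ expR (l * - s) * F (- s) <= d }.

(** The slope of F on [s, t] is at least, in absolute value, the mass of the
    source on [t, oo[, where the part of the stretch after t contributes be -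
    max(t, a). *)
Lemma profile_drop (a be l : R) F s t : stretch_profile a be l F ->
  s <= t -> t < be -> a < be -> F t + (t - s) * (be - Num.max t a) <= F s.
Proof.
move=> [Fni F0 _ FT _] st tb ab.
have g0 u : (0 <= (EFin \o stretch_source F a be 1) u)%E.
  by rewrite lee_fin stretch_source_ge0.
have mg := measurable_stretch_source a be 1 Fni.
have := tail_drop g0 mg st; rewrite !FT.
set I := (\int[mu]_(u in _) _)%E => le1.
have le2 : ((be - Num.max t a)%:E <= I)%E.
  have mb : Num.max t a < be by rewrite gt_max tb.
  have -> : ((be - Num.max t a)%:E =
      \int[mu]_(u in `[t, +oo[) (\1_`[Num.max t a, be] u)%:E)%E.
    rewrite integral_indic//.
    have -> : `[Num.max t a, be]%classic `&` `[t, +oo[%classic =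
              `[Num.max t a, be]%classic.
      apply/seteqP; split=> u /=; rewrite !in_itv/= ?andbT; first by case.
      move=> /andP[mu' ub]; split; first by rewrite mu'.
      by move: mu'; rewrite ge_max => /andP[].
    have := @lebesgue_measure_itv R `[Num.max t a, be].
    by rewrite /= lte_fin mb -EFinB => <-.
  apply: ge0_le_integral => //.
  - by apply: measurable_funTS; exact: measurable_indicE.
  - by apply: measurable_funTS.
  move=> u _; rewrite lee_fin indicE mem_setE in_itv/= ge_max.
  have [/andP[/andP[_ au] ub]|_] := boolP (_ && _).
    by rewrite stretch_source_in// au.
  by rewrite stretch_source_ge0.
rewrite -lee_fin EFinD EFinM; apply: le_trans le1.
by rewrite leeD2l// lee_wpmul2l// lee_fin subr_ge0.
Qed.

(** Ending the stretch at p < be lowers the source on ]p, be] by at least m = 1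
    - F (p - a) > 0. This mass lies to the right of the stretch, hence pays for
    the mass e (p - a) = m (be - p) added on [a, p]. *)
Lemma stretch_room (a be l : R) F p : stretch_profile a be l F ->
  0 <= a -> a < p -> p < be ->
  exists2 e : R, 0 < e & forall t,
    (tail (EFin \o stretch_source F a p (1 + e)) t <= (F t)%:E)%E.
Proof.
move=> prof a0 ap pb; have [Fni F0 F1 FT _] := prof.
pose m := 1 - F (p - a).
have pa0 : 0 < p - a by rewrite subr_gt0.
have m0 : 0 < m.
  have ab := lt_trans ap pb.
  have pab : p - a < be by lra.
  have := profile_drop prof (ltW pa0) pab ab; rewrite F1 subr0.
  have : 0 < (p - a) * (be - Num.max (p - a) a).
    by rewrite mulr_gt0// subr_gt0 gt_max pab ab.
  by rewrite /m; lra.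
pose e := m * (be - p) / (p - a).
have e0 : 0 < e by rewrite divr_gt0// mulr_gt0// subr_gt0.
exists e => // t.
have e10 : 0 <= 1 + e by lra.
set T := tail _ t.
pose w := Num.max 0 (p - t).
have le1 : (T + (m * ((be - p) * w))%:E <= (F t)%:E + (e * ((p - a) * w))%:E)%E.
  apply: (@le_trans _ _
      (T + m%:E * tail (fun u => (\1_`]p, be] u)%:E) t)%E).
    rewrite leeD2l// EFinM lee_wpmul2l ?lee_fin ?(ltW m0)//.
    by apply: tail_indic_ge; exact: ltW.
  apply: (@le_trans _ _
      ((F t)%:E + e%:E * tail (fun u => (\1_`[a, p] u)%:E) t)%E); last first.
    rewrite leeD2l// [X in (_ <= X)%E]EFinM lee_wpmul2l ?lee_fin ?(ltW e0)//.
    by apply: tail_indic_le; exact: ltW.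
  have mi1 : measurable_fun [set: R] (fun u => (\1_`]p, be] u : R)%:E).
    exact: measurable_indicE.
  have mi2 : measurable_fun [set: R] (fun u => (\1_`[a, p] u : R)%:E).
    exact: measurable_indicE.
  have ms1 := measurable_stretch_source a p (1 + e) Fni.
  have ms2 := measurable_stretch_source a be 1 Fni.
  have i0 (A : set R) u : (0 <= (\1_A u : R)%:E)%E by rewrite lee_fin.
  have s10 u : (0 <= (EFin \o stretch_source F a p (1 + e)) u)%E.
    by rewrite lee_fin stretch_source_ge0.
  have s20 u : (0 <= (EFin \o stretch_source F a be 1) u)%E.
    by rewrite lee_fin stretch_source_ge0.
  have mi1' : measurable_fun [set: R] (fun u => m%:E * (\1_`]p, be] u : R)%:E)%E.
    exact: emeasurable_funM.
  have mi2' : measurable_fun [set: R] (fun u => e%:E * (\1_`[a, p] u : R)%:E)%E.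
    exact: emeasurable_funM.
  have m1 u : (0 <= m%:E * (\1_`]p, be] u : R)%:E)%E.
    by rewrite mule_ge0 ?i0// lee_fin ltW.
  have m2 u : (0 <= e%:E * (\1_`[a, p] u : R)%:E)%E.
    by rewrite mule_ge0 ?i0// lee_fin ltW.
  rewrite -FT -!tailZl ?(ltW m0) ?(ltW e0)// -!tailD//.
  apply: le_tail.
  - by move=> u; rewrite adde_ge0.
  - exact: emeasurable_funD.
  - exact: emeasurable_funD.
  move=> u _ /=; rewrite -!EFinM -!EFinD lee_fin !indicE !mem_setE !in_itv/=.
  have [/andP[au up]|nap] := boolP (a <= u <= p).
    rewrite !stretch_source_in ?au ?up ?(le_trans up (ltW pb))//.
    by rewrite ltNge up/= mulr0 addr0 mulr1.
  rewrite [X in X + _ <= _]stretch_source_out// mulr0 addr0.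
  have [/andP[pu ub]|npb] := boolP (p < u <= be).
    rewrite stretch_source_in ?ub ?(ltW (lt_trans ap pu))// mulr1.
    have : F (u - a) <= F (p - a) by apply: Fni; rewrite lerD2r ltW.
    by rewrite /m; lra.
  rewrite mulr0 addr0 stretch_source_out//; apply: contra npb.
  move=> /andP[au ub]; rewrite ub andbT ltNge; apply: contra nap => up.
  by rewrite au.
have ee : e * ((p - a) * w) = m * ((be - p) * w).
  by rewrite /e; field; rewrite gt_eqF.
by move: le1; rewrite ee leeD2rE.
Qed.

End stretch_profiles.

(** * Sparse stretches *)

Section sparse_stretches.
Variable R : realType.
Implicit Types (F : R -> R) (a be l : R) (eps t b : nat -> R).

Lemma common_lower_bound (eps : nat -> R) N : (forall n, 0 < eps n) ->
  exists2 d : R, 0 < d & forall m, (m <= N)%N -> d <= eps m.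
Proof.
move=> e0; elim: N => [|N [d d0 ih]].
  by exists (eps 0%N) => // m; rewrite leqn0 => /eqP ->.
exists (Num.min d (eps N.+1)); first by rewrite lt_min d0 e0.
move=> m; rewrite leq_eqVlt => /predU1P[->|]; first by rewrite ge_min lexx orbT.
by rewrite ltnS => /ih dm; rewrite ge_min dm.
Qed.

(** At the n-th time the weighted influence of the m-th translate is at most
    eps n / 2 ^ (m + 1), a share of eps n that is summable over m. Each new
    time has to be far from the earlier ones for two reasons: they must not
    disturb it, and it must not disturb them; whence the minimum over all eps m
    with m <= n. *)
Lemma sparse_times a be l F eps : stretch_profile a be l F -> 0 <= be ->
  (forall n, 0 < eps n) ->
  exists t : nat -> R, [/\ t 0%N = 0, forall n, t n + be + 1 <= t n.+1
    & forall m n, m != n ->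
        expR (l * (t n - t m)) * F (t n - t m) <= eps n / 2 ^+ m.+1].
Proof.
move=> prof be0 e0.
have rP n : exists r : R, forall m s, (m <= n)%N -> r <= s ->
    expR (l * s) * F s <= eps m / 2 ^+ n.+1 /\
    expR (l * - s) * F (- s) <= eps m / 2 ^+ n.+1.
  have [d d0 dP] := common_lower_bound n e0.
  have d20 : 0 < d / 2 ^+ n.+1 by rewrite divr_gt0// exprn_gt0.
  have [r rP] := profile_decay prof d20.
  exists r => m s mn rs; have [h1 h2] := rP s rs.
  have le1 : d / 2 ^+ n.+1 <= eps m / 2 ^+ n.+1.
    by rewrite ler_pM2r ?invr_gt0 ?exprn_gt0// dP.
  by split; [apply: le_trans h1 _|apply: le_trans h2 _].
have [r {}rP] := choice rP.
pose t n := \sum_(i < n) (be + 1 + `|r i.+1|).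
have tS n : t n.+1 = t n + (be + 1 + `|r n.+1|) by rewrite /t big_ord_recr.
have tle n : t n <= t n.+1.
  by rewrite tS lerDl addr_ge0//; lra.
have gap m n : (m < n)%N -> r n <= t n - t m.
  case: n => // n; rewrite ltnS => mn; rewrite tS.
  have := nodes_le tle mn; have := ler_norm (r n.+1); lra.
have pow m n : (m <= n)%N -> eps n / 2 ^+ n.+1 <= eps n / 2 ^+ m.+1.
  move=> mn; rewrite ler_pM2l// lef_pV2 ?posrE ?exprn_gt0//.
  by rewrite ler_eXn2l ?ltr1n.
exists t; split.
- by rewrite /t big_ord0.
- by move=> n; rewrite tS -!addrA lerD2l lerD2l lerDl.
- move=> m n; rewrite neq_ltn => /orP[mn|nm].
    have [h1 _] := rP n n _ (leqnn n) (gap m n mn).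
    by apply: le_trans h1 _; exact/pow/ltnW.
  have [_] := rP m n _ (ltnW nm) (gap n m nm).
  by rewrite opprB.
Qed.

Lemma nneseries_le (f : nat -> R) (A : R) : (forall n, 0 <= f n) ->
  (forall N, \sum_(i < N) f i <= A) ->
  (\sum_(n <oo) (f n)%:E <= A%:E)%E.
Proof.
move=> f0 fA; apply: lime_le.
  by apply: is_cvg_nneseries => n _ _; rewrite lee_fin.
by apply: nearW => N; rewrite big_mkord sumEFin lee_fin.
Qed.

Lemma le_term_nneseries (f : nat -> \bar R) n : (forall n, 0 <= f n)%E ->
  (f n <= \sum_(m <oo) f m)%E.
Proof.
move=> f0; rewrite (@nneseriesD1 _ f n xpredT)// leeDl//.
by apply: nneseries_ge0.
Qed.

Lemma sum_half_powers N : \sum_(i < N) (2 ^+ i.+1)^-1 = 1 - (2 ^+ N)^-1 :> R.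
Proof.
elim: N => [|N ih]; first by rewrite big_ord0 expr0 invr1 subrr.
rewrite big_ord_recr/= ih exprS; field.
by rewrite gt_eqF// exprn_gt0.
Qed.

(** The scaling exp(- l t n) makes all terms of the same weighted size. *)
Definition superposition F l t (s : R) : \bar R :=
  (\sum_(n <oo) (expR (- l * t n) * F (s - t n))%:E)%E.

(** The term m = n has the value exp(- l t n), and sparseness bounds the
    others. *)
Lemma superposition_node a be l F eps t n : stretch_profile a be l F ->
  (forall n, 0 < eps n) ->
  (forall m n, m != n ->
    expR (l * (t n - t m)) * F (t n - t m) <= eps n / 2 ^+ m.+1) ->
  (superposition F l t (t n) <= (expR (- l * t n) * (1 + eps n))%:E)%E.
Proof.
move=> prof e0 tP; have [_ F0 F1 _ _] := prof.
apply: nneseries_le => [m|N]; first by rewrite mulr_ge0 ?expR_ge0.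
have termE m : expR (- l * t m) * F (t n - t m) =
    expR (- l * t n) * (expR (l * (t n - t m)) * F (t n - t m)).
  by rewrite mulrA -expRD; congr (expR _ * _); ring.
under eq_bigr do rewrite termE.
rewrite -mulr_sumr ler_wpM2l ?expR_ge0//.
apply: (@le_trans _ _ (\sum_(i < N) ((nat_of_ord i == n)%:R + eps n / 2 ^+ i.+1))).
  apply: ler_sum => i _; have [->|ne] := eqVneq (nat_of_ord i) n.
    rewrite subrr mulr0 expR0 F1 mul1r lerDl divr_ge0 ?exprn_ge0//.
    exact: ltW.
  by rewrite add0r; exact: tP.
rewrite big_split/=; apply: lerD.
  have [nN|Nn] := ltnP n N.
    rewrite (bigD1 (Ordinal nN))//= eqxx big1 ?addr0// => i.
    by rewrite -val_eqE/= => /negbTE ->.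
  rewrite big1 => // i _; rewrite ltn_eqF// (leq_trans (ltn_ord i))//.
by rewrite -mulr_sumr sum_half_powers ler_piMr ?(ltW (e0 n))// gerBl.
Qed.

End sparse_stretches.

(** * Infinitely many stretches *)

Section stretched_delay.
Variable R : realType.
Implicit Types (F : R -> R) (a be l : R) (eps t b : nat -> R).

(** Delay a, except that the value is frozen at t n along the n-th stretch [t n
    + a, t n + b n]; the default value of the choice operator encodes the
    absence of a stretch. *)
Definition stretched_delay a t b (u : R) : R :=
  xget (u - a) [set y | exists n, t n + a <= u <= t n + b n /\ y = t n].

Section stretched_delay_theory.
Variables (a be : R) (t b : nat -> R).
Hypotheses (t_step : forall n, t n + be + 1 <= t n.+1) (be0 : 0 <= be).
Hypotheses (a_gt0 : 0 < a) (b_le : forall n, b n <= be).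

Let tle n : t n <= t n.+1.
Proof. by have := t_step n; have := be0; lra. Qed.

Lemma stretches_separated m n : (m < n)%N -> t m + b m < t n + a.
Proof.
move=> mn; have {mn} := nodes_le tle mn; have := t_step m; have := b_le m.
have := a_gt0; lra.
Qed.

Lemma stretch_unique u m n : t m + a <= u <= t m + b m ->
  t n + a <= u <= t n + b n -> m = n.
Proof.
move=> /andP[m1 m2] /andP[n1 n2]; have [mn|nm|//] := ltngtP m n.
  by exfalso; have {mn} := stretches_separated mn; lra.
by exfalso; have {nm} := stretches_separated nm; lra.
Qed.

Lemma stretched_delay_in u n : t n + a <= u <= t n + b n ->
  stretched_delay a t b u = t n.
Proof.
move=> un; apply: xget_unique; first by exists n.
by move=> _ [m [um ->]]; rewrite (stretch_unique um un).
Qed.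

Lemma stretched_delay_out u : (forall n, ~~ (t n + a <= u <= t n + b n)) ->
  stretched_delay a t b u = u - a.
Proof.
move=> nu; apply: xgetPN => y [n [un _]].
by have := nu n; rewrite un.
Qed.

Lemma stretched_delayP u :
  (exists2 n, t n + a <= u <= t n + b n & stretched_delay a t b u = t n) \/
  (forall n, ~~ (t n + a <= u <= t n + b n)) /\
    stretched_delay a t b u = u - a.
Proof.
have [[n un]|nu] := pselect (exists n, t n + a <= u <= t n + b n).
  by left; exists n => //; exact: stretched_delay_in.
have nu' n : ~~ (t n + a <= u <= t n + b n).
  by apply/negP => un; apply: nu; exists n.
by right; split=> //; exact: stretched_delay_out.
Qed.

Lemma stretched_delay_le u : stretched_delay a t b u <= u - a.
Proof.
have [[n /andP[un _] ->]|[_ ->//]] := stretched_delayP u.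
by rewrite lerBrDr.
Qed.


Lemma stretched_delay_nd : {homo stretched_delay a t b : u v / u <= v}.
Proof.
move=> u v uv.
have [[n /andP[vn vn'] ->]|[nv ->]] := stretched_delayP v; last first.
  by apply: le_trans (stretched_delay_le u) _; rewrite lerD2r.
have [[m /andP[um um'] ->]|[nu ->]] := stretched_delayP u.
  have [mn|nm] := leqP m n; first exact: nodes_le.
  by have {nm} := stretches_separated nm; lra.
rewrite leNgt; apply/negP => nu'; have := nu n; rewrite negb_and -!ltNge.
by move=> /orP[]; lra.
Qed.

End stretched_delay_theory.

(** The superposition v of the translates of F is a supersolution for the
    stretched delay. On the n-th stretch v (tau u) = v (t n) is at most exp(- l
    t n) (1 + eps n), which is the n-th term of the sum of the sources with
    raised value 1 + eps n; off the stretches v (tau u) equals that sum term by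
    term. Applying T and [stretch_room] to each term bounds T(v o tau) by v. *)
Lemma stretched_delay_realized a be l F (b : R) : stretch_profile a be l F ->
  0 < a -> a < b <= be -> delay_range_realized a b.
Proof.
move=> prof a0 /andP[ab bbe]; have [Fni F0 F1 _ _] := prof.
pose bn n : R := b - (b - a) / n.+2%:R.
have ba0 : 0 < b - a by rewrite subr_gt0.
have bn_lt n : bn n < b by rewrite /bn gtrBl divr_gt0.
have bn_le n : bn n <= be by apply: le_trans bbe; exact: ltW.
have bn_gt n : a < bn n.
  have : (b - a) / n.+2%:R < b - a.
    by rewrite ltr_pdivrMr// ltr_pMr// ltr1n.
  by rewrite /bn; set c := _ / _; lra.
have be0 : 0 <= be by rewrite (le_trans _ (bn_le 0%N))// ltW// (lt_trans a0).
have room n : exists e : R, 0 < e /\ forall s,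
    (tail (EFin \o stretch_source F a (bn n) (1 + e)) s <= (F s)%:E)%E.
  have bnbe : bn n < be by exact: lt_le_trans bbe.
  have [e e0 eP] := stretch_room prof (ltW a0) (bn_gt n) bnbe.
  by exists e.
have [eps epsP] := choice room.
have e0 n : 0 < eps n by have [] := epsP n.
have roomP n s := (epsP n).2 s.
have [t [t0 tstep tsparse]] := sparse_times prof be0 e0.
have tle n : t n <= t n.+1 by have := tstep n; lra.
have t_ge0 n : 0 <= t n by rewrite -t0; exact: nodes_le.
have tge n : n%:R <= t n.
  elim: n => [|n ih]; first by rewrite t0.
  by rewrite -natr1; have := tstep n; lra.
pose tau := stretched_delay a t bn.
have tau_in u n : t n + a <= u <= t n + bn n -> tau u = t n.
  exact: (stretched_delay_in tstep).
have tauP u : (exists2 n, t n + a <= u <= t n + bn n & tau u = t n) \/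
    (forall n, ~~ (t n + a <= u <= t n + bn n)) /\ tau u = u - a.
  exact: stretched_delayP tstep be0 a0 bn_le u.
have tau_le u : tau u <= u - a.
  exact: (stretched_delay_le tstep be0 a0 bn_le u).
have tau_nd : {homo tau : u v / u <= v}.
  exact: (stretched_delay_nd tstep be0 a0 bn_le).
pose c n := expR (- l * t n).
pose v := superposition F l t.
have term0 n s : (0 <= (c n * F (s - t n))%:E)%E.
  by rewrite lee_fin mulr_ge0 ?expR_ge0.
have v0 s : (0 <= v s)%E by apply: nneseries_ge0 => n _ _; exact: term0.
have vni s s' : s <= s' -> (v s' <= v s)%E.
  move=> ss'; apply: lee_nneseries => n *; first exact: term0.
  by rewrite lee_fin ler_wpM2l ?expR_ge0// Fni// lerD2r.
have vnode n : (v (t n) <= (c n * (1 + eps n))%:E)%E.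
  exact: superposition_node prof e0 tsparse.
have vfin s : 0 <= s -> v s \is a fin_num.
  move=> s0; rewrite ge0_fin_numE//; apply: le_lt_trans (vni _ _ s0) _.
  by rewrite -t0; apply: le_lt_trans (vnode 0%N) _; rewrite ltry.
pose K n u := stretch_source F a (bn n) (1 + eps n) u.
have e10 n : 0 <= 1 + eps n by rewrite addr_ge0// ltW.
have K0 n u : 0 <= K n u by rewrite stretch_source_ge0.
have mK n : measurable_fun [set: R] (EFin \o K n).
  exact: measurable_stretch_source.
have pw u : (v (tau u) <= \sum_(n <oo) ((c n)%:E * (K n (u - t n))%:E))%E.
  have g0 n : (0 <= (c n)%:E * (K n (u - t n))%:E)%E.
    by rewrite mule_ge0// lee_fin ?expR_ge0.
  have [[n un ->]|[nu ->]] := tauP u.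
    apply: le_trans (vnode n) _.
    apply: (@le_trans _ _ ((c n)%:E * (K n (u - t n))%:E)%E); last first.
      exact: (@le_term_nneseries R (fun n => (c n)%:E * (K n (u - t n))%:E)%E).
    rewrite /K stretch_source_in -?EFinM//.
    by rewrite lerBrDl lerBlDl.
  apply: lee_nneseries => n *; first exact: term0.
  rewrite -EFinM lee_fin ler_wpM2l ?expR_ge0// /K stretch_source_out.
    by rewrite addrAC.
  by rewrite lerBrDl lerBlDl; exact: nu.
have mshift n : measurable_fun [set: R] (fun u => (K n (u - t n))%:E).
  apply: (measurableT_comp (mK n)).
  by apply: measurable_funB => //; exact: measurable_id.
have mterm n : measurable_fun [set: R] (fun u => (c n)%:E * (K n (u - t n))%:E)%E.
  exact: emeasurable_funM.
have gn0 n u : (0 <= (c n)%:E * (K n (u - t n))%:E)%E.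
  by rewrite mule_ge0// lee_fin ?expR_ge0.
have superE s :
    (tail (fun u => \sum_(n <oo) ((c n)%:E * (K n (u - t n))%:E)) s <= v s)%E.
  rewrite tail_series//; apply: lee_nneseries.
    by move=> n _ _; exact: tail_ge0.
  move=> n _; rewrite tailZl ?expR_ge0//.
    rewrite (@tail_translate _ (EFin \o K n))//.
      rewrite [leRHS]EFinM lee_wpmul2l ?lee_fin ?expR_ge0//.
      exact: roomP.
    by move=> u; rewrite lee_fin.
  by move=> u; rewrite lee_fin.
(* Negative arguments are cut off because v may be infinite there. *)
pose V s := fine (v (Num.max s 0)).
have max0 (s : R) : 0 <= Num.max s 0 by rewrite le_max lexx orbT.
have VE s : 0 <= s -> (V s)%:E = v s.
  by move=> s0; rewrite /V max_l// fineK// vfin.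
have Vni : nonincreasing_fun V.
  move=> s s' ss'; rewrite /V; apply: fine_le; [exact: vfin|exact: vfin|].
  by apply: vni; rewrite ge_max !le_max ss' lexx orbT.
(* T0 is the middle of the first stretch: there tau T0 = t 0 = 0, so that the
   initial interval is [0, T0], and on it F falls with slope at least be - T0
   in absolute value. *)
pose T0 := (a + bn 0%N) / 2.
have T0a : a < T0 by rewrite /T0; have := bn_gt 0%N; lra.
have T0b : T0 < bn 0%N by rewrite /T0; have := bn_gt 0%N; lra.
have T00 : 0 < T0 by exact: lt_trans T0a.
have T0be : T0 < be by exact: lt_le_trans T0b _.
have tauT0 : tau T0 = 0.
  by rewrite (tau_in _ 0%N) t0// !add0r !ltW.
have k0 : 0 < be - T0 by rewrite subr_gt0.
have tau0 u : T0 <= u -> 0 <= tau u by move=> Tu; rewrite -tauT0; exact: tau_nd.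
have [|||||x [xsol xpos xdec]] :=
  @solution_of_supersolution R tau V T0 (be - T0) tau_nd _ T00 k0 Vni.
- by rewrite tauT0.
- by move=> s; exact: fine_ge0.
- move=> s Ts; rewrite VE ?(le_trans (ltW T00))//.
  apply: le_trans (superE s); apply: le_tail.
  + by move=> u; rewrite lee_fin fine_ge0.
  + apply/measurable_EFinP; apply: nonincreasing_measurable => //.
    by move=> r r' rr'; apply: Vni; exact: tau_nd.
  + by apply: ge0_emeasurable_sum => n *; [exact: gn0|exact: mterm].
  + move=> u su /=; rewrite VE; first exact: pw.
    by rewrite tau0// (le_trans Ts)// ltW.
- move=> s sT.
  pose s' := Num.max s 0; have s'0 : 0 <= s' by exact: max0.
  have s'T : s' <= T0 by rewrite ge_max sT ltW.
  have -> : V s = V s' by rewrite /V [Num.max s' 0]max_l.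
  rewrite -/s' -lee_fin EFinD !VE ?(ltW T00)//.
  have Fdrop : F T0 + (be - T0) * (T0 - s') <= F s'.
    have abe : a < be by exact: lt_trans T0be.
    have := profile_drop prof s'T T0be abe.
    by rewrite (max_l (ltW T0a)) mulrC.
  have kge0 : 0 <= (be - T0) * (T0 - s').
    by rewrite mulr_ge0 ?subr_ge0// ltW.
  rewrite /v /superposition (@nneseriesD1 _ _ 0%N xpredT)//; last first.
    by move=> n _; exact: term0.
  rewrite [leRHS](@nneseriesD1 _ _ 0%N xpredT)//; last first.
    by move=> n _; exact: term0.
  rewrite -addeA (addeC _ (_ * _)%:E) addeA -EFinD.
  apply: leeD.
    by rewrite t0 mulr0 expR0 !mul1r !subr0 lee_fin.
  apply: lee_nneseries => n *; first exact: term0.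
  by rewrite lee_fin ler_wpM2l ?expR_ge0// Fni// lerD2r.
- move=> s Ts; exists (s + a / 2); first by rewrite ltrDl divr_gt0.
  by apply: le_lt_trans (tau_le _) _; lra.
have delay u : a <= u - tau u <= b.
  have ta := tau_le u; have [[n un e]|[_ e]] := tauP u; rewrite e in ta *.
    have := bn_lt n; have /andP[n1 n2] := un => bb.
    by apply/andP; split; lra.
  by apply/andP; split; lra.
exists tau; split => //.
- by move=> u; apply: le_trans (tau_le u) _; rewrite gerBl ltW.
- by apply: (@bounded_delay_cvg _ _ b) => u; have /andP[] := delay u.
- by exists T0, `[0, +oo[%classic, x.
- apply: (@limf_delay _ _ a b 0) => // T e epos.
    pose n := (Num.truncn `|T|).+1; exists (t n + a).
      have : `|T| < n%:R by exact: truncnS_gt.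
      have := ler_norm T; have := tge n; lra.
    rewrite (tau_in _ n); first by rewrite addrAC subrr add0r lerDl ltW.
    by rewrite lexx lerD2l ltW.
  pose n := (Num.truncn (`|T| + (b - a) / e)).+1.
  have nT : `|T| + (b - a) / e < n%:R by exact: truncnS_gt.
  have q1 := normr_ge0 T.
  have q2 : 0 <= (b - a) / e by rewrite divr_ge0// ltW.
  have Tn : T <= t n by have := ler_norm T; have := tge n; lra.
  exists (t n + bn n); first by have := bn_gt n; lra.
  rewrite (tau_in _ n); last by rewrite lexx lerD2l ltW.
  rewrite addrAC subrr add0r lerD2l lerN2 ler_pdivrMr// mulrC -ler_pdivrMr//.
  have : n%:R <= n.+2%:R :> R by rewrite ler_nat -addn2 leq_addr.
  lra.
Qed.

End stretched_delay.

(** * The profile defined by the series Phi *)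

Section profile_of_Phi.
Variable R : realType.
Implicit Types (a be k t s : R) (g : R -> R).

(** An exponential bound makes the integral finite, so that its real-valued and
    extended versions agree; and T reproduces the bound up to a constant. *)
Lemma tail_op_exp g (C k : R) : 0 < k -> 0 <= C -> (forall u, 0 <= g u) ->
  measurable_fun [set: R] (EFin \o g) ->
  (forall u, g u <= C * expR (- k * u)) ->
  (forall t, tail (EFin \o g) t = (tail_op g t)%:E) /\
  (forall t, tail_op g t <= C * (4 / k ^+ 2) * expR (- k * t)).
Proof.
move=> k0 C0 g0 mg gC.
have mE : measurable_fun [set: R] (fun u : R => (expR (- k * u))%:E).
  apply/measurable_EFinP; apply: continuous_measurable_fun => u.
  apply: continuous_comp; last exact: continuous_expR.
  exact: mulrl_continuous.
have e0 u : (0 <= (expR (- k * u))%:E :> \bar R)%E by rewrite lee_fin expR_ge0.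
have bound t : (tail (EFin \o g) t <= (C * (4 / k ^+ 2) * expR (- k * t))%:E)%E.
  apply: (@le_trans _ _ (tail (fun u => C%:E * (expR (- k * u))%:E)%E t)).
    apply: le_tail => //; first exact: emeasurable_funM.
    by move=> u _; rewrite -EFinM lee_fin.
  rewrite tailZl// -[X in (_ <= X%:E)%E]mulrA EFinM lee_wpmul2l ?lee_fin//.
  exact: tail_exp_le.
have fin t : tail (EFin \o g) t = (tail_op g t)%:E.
  rewrite tail_opE fineK// ge0_fin_numE; last first.
    by apply: tail_ge0 => u; rewrite lee_fin.
  by apply: le_lt_trans (bound t) _; rewrite ltry.
by split=> // t; rewrite -lee_fin -fin.
Qed.

Lemma exp_decay (C k d : R) : 0 <= C -> 0 < k -> 0 < d ->
  exists r : R, forall s, r <= s -> C * expR (- k * s) <= d.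
Proof.
move=> C0 k0 d0; exists (C / d / k) => s.
rewrite ler_pdivrMr// ler_pdivrMr// => Cs.
rewrite mulNr expRN ler_pdivrMr ?expR_gt0//.
have := expR_ge1Dx (k * s) => h.
apply: le_trans Cs _; rewrite mulrC ler_wpM2l ?(ltW d0)// mulrC.
lra.
Qed.

Section terms.
Variables a be : R.

(** The function whose image under T is the j-th term of the series. *)
Definition Phi_source (j : nat) : R -> R :=
  if j is i.+1 then fun u => \1_(~` `[a, be]) u * Phi_term a be i (u - a)
  else \1_`[a, be].

Lemma Phi_termE j : Phi_term a be j = tail_op (Phi_source j).
Proof. by case: j. Qed.

(** The terms decay at every exponential rate k; the constant depends on the
    term, and nothing is claimed about its size. *)
Lemma Phi_term_spec j :
  [/\ nonincreasing_fun (Phi_term a be j) /\ (forall t, 0 <= Phi_term a be j t),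
      forall u, 0 <= Phi_source j u,
      measurable_fun [set: R] (EFin \o Phi_source j),
      forall t, tail (EFin \o Phi_source j) t = (Phi_term a be j t)%:E
    & forall k, 0 < k -> exists C, 0 <= C /\
        forall t, Phi_term a be j t <= C * expR (- k * t)].
Proof.
have step i : (forall u, 0 <= Phi_source i u) ->
    measurable_fun [set: R] (EFin \o Phi_source i) ->
    (forall k, 0 < k -> exists2 C, 0 <= C &
      forall u, Phi_source i u <= C * expR (- k * u)) ->
  [/\ nonincreasing_fun (Phi_term a be i) /\ (forall t, 0 <= Phi_term a be i t),
      forall u, 0 <= Phi_source i u,
      measurable_fun [set: R] (EFin \o Phi_source i),
      forall t, tail (EFin \o Phi_source i) t = (Phi_term a be i t)%:E
    & forall k, 0 < k -> exists C, 0 <= C /\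
        forall t, Phi_term a be i t <= C * expR (- k * t)].
  move=> s0 ms sC.
  have tE t : tail (EFin \o Phi_source i) t = (Phi_term a be i t)%:E.
    have [C C0 CP] := sC 1 ltr01.
    by have [-> _] := tail_op_exp ltr01 C0 s0 ms CP; rewrite Phi_termE.
  have es0 u : (0 <= (EFin \o Phi_source i) u)%E by rewrite lee_fin.
  split=> //.
  - split; first by move=> s t st; rewrite -lee_fin -!tE; exact: le_tail_point.
    by move=> t; rewrite -lee_fin -tE; exact: tail_ge0.
  - move=> k k0; have [C C0 CP] := sC k k0.
    exists (C * (4 / k ^+ 2)); split.
      by rewrite mulr_ge0// divr_ge0// exprn_ge0// ltW.
    by have [_ ] := tail_op_exp k0 C0 s0 ms CP; rewrite Phi_termE.
elim: j => [|j [[ni p0] s0 ms tE pC]]; apply: step.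
- by [].
- exact: measurable_indicE.
- move=> k k0; exists (expR (k * be)); first exact: expR_ge0.
  move=> u /=; rewrite -expRD indicE mem_setE in_itv/=.
  have [/andP[_ ub]|_] := boolP (_ && _); last exact: expR_ge0.
  rewrite -expR0 ler_expR mulNr -mulrBr mulr_ge0 ?subr_ge0//.
  exact: ltW.
- by move=> u /=; rewrite mulr_ge0.
- apply/measurable_EFinP; apply: measurable_funM.
    by apply: measurable_indic; exact: measurableC.
  apply: nonincreasing_measurable => // s t st.
  by apply: ni; rewrite lerD2r.
- move=> k k0; have [C [C0 CP]] := pC k k0.
  exists (C * expR (k * a)); first by rewrite mulr_ge0// expR_ge0.
  move=> u /=; apply: (@le_trans _ _ (Phi_term a be j (u - a))).
    by rewrite ler_piMl// indicE lern1 leq_b1.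
  apply: le_trans (CP _) _; rewrite -mulrA ler_wpM2l//.
  by rewrite -expRD ler_expR le_eqVlt; apply/orP; left; apply/eqP; ring.
Qed.

End terms.

(** Summing T (Phi_source j) over j by monotone convergence gives the equation
    of a profile: the sources add up to 1 on [a, be] and to F (u - a)
    elsewhere. For the decay, approximate F in the weighted norm by a partial
    sum, which decays faster than the weight at + oo and grows more slowly than
    its inverse at - oo. *)
Lemma Phi_profile a be : 0 < a -> Eval a be = 1 ->
  stretch_profile a be (2 / a) (Phi a be).
Proof.
move=> a0; rewrite /Eval.
set S := [set F | wspace a F /\
    wnorm a (fun t => F t - \sum_(j < n) Phi_term a be j t) @[n --> \oo] --> 0%E].
have -> : Phi a be = xget (fun=> 0) S by [].
case: xgetP => [F _ [_ SF] F1|_ /eqP]; last by rewrite eq_sym oner_eq0.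
have l0 : 0 < 2 / a by rewrite divr_gt0.
pose ph := Phi_term a be.
have spec := Phi_term_spec a be.
pose P n t : R := \sum_(j < n) ph j t.
have unif d : 0 < d -> exists n0, forall n, (n0 <= n)%N ->
    forall t, expR (2 / a * t) * `|F t - P n t| <= d.
  move=> d0.
  have nb : nbhs (0%E : \bar R) [set z | (z < d%:E)%E].
    have nb0 : \forall r \near (0 : R), (r%:E < d%:E)%E.
      by apply: filterS (lt_nbhsl d0) => r; rewrite lte_fin.
    exact: nb0.
  have [n0 _ n0P] := SF _ nb.
  exists n0 => n /n0P/= lt t.
  rewrite -lee_fin; apply: le_trans (ltW lt).
  by apply: ereal_sup_ubound; exists t => //; rewrite mulrAC.
have cvgP t : P n t @[n --> \oo] --> F t.
  apply/cvgrPdist_le => e e0.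
  have ee0 : 0 < e * expR (2 / a * t) by rewrite mulr_gt0 ?expR_gt0.
  have [n0 n0P] := unif _ ee0.
  exists n0 => // n /= /n0P/(_ t).
  by rewrite mulrC ler_pM2r ?expR_gt0.
have series t : (\sum_(j <oo) (ph j t)%:E)%E = (F t)%:E.
  apply/cvg_lim => //.
  under eq_fun do rewrite big_mkord sumEFin.
  apply: cvg_EFin; first by apply: nearW.
  exact: cvgP.
have ph0 j t : (0 <= (ph j t)%:E)%E by rewrite lee_fin; have [[]] := spec j.
have PC n k : 0 < k -> exists2 C, 0 <= C & forall t, P n t <= C * expR (- k * t).
  move=> k0; elim: n => [|n [C C0 CP]].
    by exists 0 => // t; rewrite /P big_ord0 mul0r.
  have [_ _ _ _ /(_ k k0)[C' [C'0 C'P]]] := spec n.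
  exists (C + C'); first exact: addr_ge0.
  by move=> t; rewrite /P big_ord_recr/= mulrDl lerD// CP.
have F0 t : 0 <= F t.
  by rewrite -lee_fin -series; apply: nneseries_ge0 => n _ _; exact: ph0.
have Fni : nonincreasing_fun F.
  move=> s t st; rewrite -lee_fin -!series; apply: lee_nneseries => n *.
    exact: ph0.
  by rewrite lee_fin; have [[+ _] _ _ _ _] := spec n; apply.
split=> //.
- move=> t; rewrite -series.
  have s0 j u : (0 <= (EFin \o Phi_source a be j) u)%E.
    by rewrite lee_fin; have [] := spec j.
  have ms j : measurable_fun [set: R] (EFin \o Phi_source a be j).
    by have [] := spec j.
  rewrite (@eq_tail _ _ (fun u => \sum_(j <oo) (EFin \o Phi_source a be j) u)%E).
    rewrite tail_series//; apply: eq_eseriesr => j _.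
    by have [] := spec j.
  move=> u _.
  rewrite (@nneseries_recl _ xpredT)// -nneseries_addn//.
  under eq_eseriesr do rewrite addn1 /=.
  under eq_eseriesr do rewrite EFinM.
  rewrite nneseriesZl// series /= /stretch_source mul1r.
  by rewrite -EFinM -EFinD.
- move=> d d0; have d20 : 0 < d / 2 by rewrite divr_gt0.
  have [n nP] := unif _ d20.
  (* At + oo twice the rate of the weight is used, at - oo half of it. *)
  have ll0 : 0 < 2 * (2 / a) by rewrite mulr_gt0.
  have l20 : 0 < 2 / a / 2 by rewrite divr_gt0.
  have [C C0 CP] := PC n _ ll0; have [C' C'0 CP'] := PC n _ l20.
  have [r rP] := exp_decay C0 l0 d20.
  have [r' rP'] := exp_decay C'0 l20 d20.
  have est t : expR (2 / a * t) * F t <= expR (2 / a * t) * P n t + d / 2.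
    have := nP n (leqnn n) t.
    have : expR (2 / a * t) * (F t - P n t) <=
        expR (2 / a * t) * `|F t - P n t|.
      by rewrite ler_wpM2l ?expR_ge0// ler_norm.
    lra.
  exists (Num.max r r') => s; rewrite ge_max => /andP[rs r's]; split.
    apply: le_trans (est s) _.
    have := rP s rs.
    have : expR (2 / a * s) * P n s <= C * expR (- (2 / a) * s).
      apply: (@le_trans _ _ (expR (2 / a * s) * (C * expR (- (2 * (2 / a)) * s)))).
        by rewrite ler_wpM2l ?expR_ge0.
      rewrite mulrCA -expRD ler_wpM2l// ler_expR le_eqVlt.
      by apply/orP; left; apply/eqP; ring.
    lra.
  apply: le_trans (est (- s)) _.
  have := rP' s r's.
  have : expR (2 / a * - s) * P n (- s) <= C' * expR (- (2 / a / 2) * s).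
    apply: (@le_trans _ _ (expR (2 / a * - s) * (C' * expR (- (2 / a / 2) * - s)))).
      by rewrite ler_wpM2l ?expR_ge0.
    rewrite mulrCA -expRD ler_wpM2l// ler_expR le_eqVlt.
    by apply/orP; left; apply/eqP; field; rewrite gt_eqF.
  lra.
Qed.

End profile_of_Phi.

(** * The theorem *)

Unset Implicit Arguments.
Set Strict Implicit.

Theorem theorem2p15 (R : realType) (a b : R) :
  0 <= a <= 2 / expR 1 ->
  a <= b <= beta a ->
  exists tau : R -> R,
    [/\ {homo tau : s t / s <= t},
        forall t, tau t <= t,
        tau t @[t --> +oo] --> +oo,
        exists (t0 : R) (J : set R) (x : R -> R),
          [/\ solution tau t0 J x,
              forall t, J t -> 0 < x t
            & forall s t, J s -> J t -> s < t -> x t < x s]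
      & limf_einf (fun t : R => (t - tau t)%:E) +oo = a%:E /\
        limf_esup (fun t : R => (t - tau t)%:E) +oo = b%:E].
Proof.
move=> a0e /andP[ab bbeta]; have /andP[a0 _] := a0e.
move: ab; rewrite le_eqVlt => /predU1P[<-|ab].
  exact: constant_delay_realized.
move: bbeta; rewrite /beta; case: ifPn => [/eqP aE|a_neq0].
  by subst a => bs; apply: vanishing_delay_realized; rewrite ab.
case: ifPn => [/eqP <-|_]; first by rewrite leNgt ab.
case: xgetP => [be _ [_ Eval1] bbe|_ b0]; last first.
  by have := lt_le_trans ab b0; rewrite ltNge a0.
have a_gt0 : 0 < a by rewrite lt_neqAle eq_sym a_neq0.
apply: (stretched_delay_realized (Phi_profile a_gt0 Eval1) a_gt0).
by rewrite ab.
Qed.
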